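(* Let $\rho$ be a symmetric probability measure on $\mathbb{R}$ which is not the Dirac mass at $0$ and which has a finite fifth moment, i.e. $\int_{\mathbb{R}}|z|^5\,d\rho(z)<+\infty$. Denote by $\sigma^2=\int_{\mathbb{R}} z^2\,d\rho(z)$ the variance of $\rho$ and by $\mu_4=\int_{\mathbb{R}} z^4\,d\rho(z)$ its fourth moment. For each $n\geq 1$ let $(X_n^1,\dots,X_n^n)$ be a random vector with distribution $\widetilde{\mu}_{n,\rho}$, and put $S_n=X_n^1+\dots+X_n^n$ and $T_n=(X_n^1)^2+\dots+(X_n^n)^2$. Then, as $n\to\infty$, the random variables $$\frac{S_n}{n^{1/4}\sqrt{T_n}}$$ converge in distribution to the probability measure on $\mathbb{R}$ with density (with respect to Lebesgue measure $ds$) $$s\longmapsto \left(\frac{4\mu_4}{3\sigma^4}\right)^{1/4}\Gamma\left(\frac14\right)^{-1}\exp\left(-\frac{\mu_4}{12\sigma^4}s^4\right).$$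
   Context: For a probability measure $\rho$ on $\mathbb{R}$ which is not the Dirac mass at $0$ and for $n\geq 1$, $\widetilde{\mu}_{n,\rho}$ is the probability measure on $\mathbb{R}^n$ defined by $$d\widetilde{\mu}_{n,\rho}(x_1,\dots,x_n)=\frac{1}{Z_n}\exp\left(\frac12\,\frac{(x_1+\dots+x_n)^2}{x_1^2+\dots+x_n^2}\right)\mathbf{1}_{\{x_1^2+\dots+x_n^2>0\}}\prod_{i=1}^n d\rho(x_i),$$ where $Z_n$ is the normalization constant. In particular $T_n>0$ almost surely. A measure $\rho$ on $\mathbb{R}$ is symmetric if it is invariant under $x\mapsto -x$. $\Gamma$ is the Euler Gamma function. *)

(* Defs.v *)
From HB Require Import structures.
From mathcomp Require Import all_boot all_order all_algebra.
From mathcomp Require Import all_classical all_reals all_analysis.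
From mathcomp Require Import measurable_realfun.

Set Implicit Arguments.
Unset Strict Implicit.
Unset Printing Implicit Defensive.
Import Order.TTheory GRing.Theory Num.Theory.
Import numFieldNormedType.Exports.

Local Open Scope classical_set_scope.
Local Open Scope ring_scope.

Section power_probability.
Context {d : measure_display} {T : measurableType d} {R : realType}.

Definition tuple_cons n (p : T * n.-tuple T) : n.+1.-tuple T :=
  [tuple of p.1 :: p.2].

Let measurable_tuple_cons n :
  measurable_fun [set: T * n.-tuple T] (@tuple_cons n).
Proof. exact: (measurable_cons (f := fst) (g := snd)). Qed.

HB.instance Definition _ n := isMeasurableFun.Build _ _ _ _ (@tuple_cons n)
  (@measurable_tuple_cons n).

(* The n-fold product of rho with itself: the library only has binary products,
   so T^(n+1) is identified with T * T^n. *)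
Fixpoint power_prob (rho : probability T R) n : probability (n.-tuple T) R :=
  match n with
  | 0 => \d_[tuple]
  | n.+1 => distribution (rho \x power_prob rho n)%E (@tuple_cons n)
  end.

Lemma power_prob_box (rho : probability T R) n (A : 'I_n -> set T) :
  (forall i, measurable (A i)) ->
  power_prob rho n [set x | forall i, A i (tnth x i)] =
  (\prod_(i < n) rho (A i))%E.
Proof.
elim: n A => [A _|n IH A mA].
  by rewrite big_ord0 /= diracE mem_set//= => -[].
rewrite big_ord_recl -IH; last by move=> i; exact: mA.
rewrite /= /distribution /pushforward /=.
rewrite -product_measure1E//; last first.
  rewrite (_ : [set _ | _] = \bigcap_(i in [set: 'I_n])
      ((@tnth n T) ^~ i @^-1` A (lift ord0 i))); last first.
    by apply/seteqP; split => x /= h i; [move=> _; exact: h|exact: h].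
  apply: fin_bigcap_measurable => // i _.
  by rewrite -[X in measurable X]setTI; apply: measurable_tnth.
congr ((_ \x _)%E _); apply/seteqP; split => -[a x] /=.
  move=> h; split; first by have := h ord0; rewrite tnth0.
  by move=> i; have := h (lift ord0 i); rewrite tnthS.
move=> [h0 h] i; case: (unliftP ord0 i) => [j ->|->]; last by rewrite tnth0.
by rewrite tnthS; exact: h.
Qed.

End power_probability.

Section curie_weiss.
Context {R : realType}.

Definition sumS n (x : n.-tuple R) : R := \sum_(i < n) tnth x i.

Definition sumT n (x : n.-tuple R) : R := \sum_(i < n) tnth x i ^+ 2.

Definition cw_weight n (x : n.-tuple R) : R :=
  expR (2^-1 * (sumS x ^+ 2 / sumT x)) * \1_[set y | 0 < @sumT n y] x.

Definition cw_Z (rho : probability R R) n : R :=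
  \int[power_prob rho n]_x cw_weight x.

Definition cw_law (rho : probability R R) n (A : set (n.-tuple R)) : \bar R :=
  ((cw_Z rho n)^-1%:E * \int[power_prob rho n]_(x in A) (cw_weight x)%:E)%E.

Definition self_normalized n (x : n.-tuple R) : R :=
  sumS x / (n%:R `^ 4^-1 * Num.sqrt (sumT x)).

Let measurable_self_normalized n :
  measurable_fun [set: n.-tuple R] (@self_normalized n).
Proof.
have mt i : measurable_fun [set: n.-tuple R] (fun x => tnth x i : R).
  exact: measurable_tnth.
have mS : measurable_fun [set: n.-tuple R] (@sumS n).
  exact: measurable_sum.
have mT : measurable_fun [set: n.-tuple R] (@sumT n).
  by apply: measurable_sum => i; exact: measurable_funX.
have T0 x : 0 <= @sumT n x by apply: sumr_ge0 => i _; exact: sqr_ge0.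
rewrite (_ : @self_normalized n = fun x =>
   sumS x * ((n%:R `^ 4^-1)^-1 * sumT x `^ (- 2^-1))); last first.
  by apply/funext => x; rewrite /self_normalized invfM powRN powR12_sqrt.
apply: measurable_funM => //; apply: measurable_funM => //.
exact: (measurableT_comp (measurable_powR _)).
Qed.

HB.instance Definition _ n := isMeasurableFun.Build _ _ _ _
  (@self_normalized n) (@measurable_self_normalized n).

Definition Gamma (a : R) : R :=
  \int[lebesgue_measure]_(x in `]0, +oo[) (x `^ (a - 1) * expR (- x)).

Definition limit_density (sigma2 mu4 : R) (s : R) : R :=
  ((4 * mu4) / (3 * sigma2 ^+ 2)) `^ 4^-1 * (Gamma 4^-1)^-1 *
  expR (- (mu4 / (12 * sigma2 ^+ 2)) * s ^+ 4).

End curie_weiss.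

Arguments cw_law {R} rho n A.
Arguments self_normalized {R} n x.

Definition cvg_in_distribution {R : realType} (d : nat -> measure_display)
    (Omega : forall n, measurableType (d n))
    (P : forall n, probability (Omega n) R)
    (Y : forall n, {RV (P n) >-> R})
    (nu : probability R R) : Prop :=
  forall f : R -> R, continuous f -> bounded_fun f ->
    ('E_(P n)[f \o Y n] @[n --> \oo] --> \int[nu]_s (f s)%:E)%E.

Arguments cvg_in_distribution {R d Omega} P Y nu.

(* Main.v *)
Require Import Defs.
From HB Require Import structures.
From mathcomp Require Import all_boot all_order all_algebra.
From mathcomp Require Import all_classical all_reals all_analysis.
From mathcomp Require Import measurable_realfun.
From mathcomp Require Import ring lra.
Import Order.TTheory GRing.Theory Num.Theory.
Import numFieldNormedType.Exports.
Local Open Scope classical_set_scope.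
Local Open Scope ring_scope.

Set Implicit Arguments.
Unset Strict Implicit.
Unset Printing Implicit Defensive.

(** Write U = S_n / sqrt T_n, so that the weight is exp (U^2/2) on {T_n > 0} and
    the variable of interest is V = U / n^(1/4).

    The square in the exponent is linearized by a Gaussian: adding to V an
    independent centred Gaussian of variance n^(-1/2) turns the weighted law into
    one whose joint density with the vector x is proportional to
    exp (- sqrt n s^2 / 2 + sqrt n s V) (exp_kernelE).  For fixed s this is an
    exponential weight in S_n whose coefficient depends on x only through T_n,
    so the symmetry of rho allows one to average over the signs of the
    coordinates (integral_symmetrize).  Because the squares of
    y_i = n^(1/4) s x_i / sqrt T_n add up to sqrt n s^2, what remains is exactly
    the product of the numbers cosh y_i * exp (- y_i^2 / 2).

    Everything then follows from the two global inequalities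
    - y^4 / 12 <= ln (cosh y) - y^2 / 2 <= - y^4 / (12 (1 + y^2))
    (cosh_gauss_ge, cosh_gauss_le).  On the one hand the exponent of the product
    is close to - (s^4 / 12) * n * (sum x_i^4) / T_n^2, with an error controlled
    by the fifth powers, and the laws of large numbers for x^2 and x^4 give the
    limit exp (- mu4 s^4 / (12 sigma2^2)) for each s (cosh_kernel_dist, weak_law,
    cvg_tilted_mass).  On the other hand t^2 / (1 + t) being convex, the
    constraint on the sum of the y_i^2 alone bounds the product by
    exp (- (s^2 - 1) / 12), uniformly in n and x (cosh_kernel_le).  Dominated
    convergence gives the limit of the integrals of test functions against the
    smoothed law (cvg_integral_tilted_mass).

    The Gaussian noise has variance n^(-1/2) and does not affect the limit: a
    bounded continuous f satisfies
    |f u - f s| <= e + e s^2 + C (s - u)^2 (quadratic_modulus), and the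
    second moments on the right are under control (joint_integral_compare).
    The normalization of the limit density is the substitution x = k s^4 in the
    integral defining Gamma (1/4) (integral_quartic). *)

(** * Two-sided bounds for cosh y * exp (- y ^ 2 / 2) *)

Section hyperbolic.
Context {R : realType}.
Implicit Types x y : R.

Definition cosh y : R := (expR y + expR (- y)) / 2.
Definition sinh y : R := (expR y - expR (- y)) / 2.

Lemma cosh_gt0 y : 0 < cosh y.
Proof. by rewrite divr_gt0// addr_gt0// expR_gt0. Qed.

Lemma coshN y : cosh (- y) = cosh y.
Proof. by rewrite /cosh opprK addrC. Qed.

Lemma is_derive_cosh y : is_derive y 1 cosh (sinh y).
Proof.
rewrite /cosh /sinh.
apply: is_derive_eq; rewrite /GRing.scale/=; lra.
Qed.

Lemma is_derive_sinh y : is_derive y 1 sinh (cosh y).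
Proof.
rewrite /cosh /sinh.
apply: is_derive_eq; rewrite /GRing.scale/=; lra.
Qed.

Lemma le_at0_of_derive_ge0 (f df : R -> R) x :
  (forall y, is_derive y 1 f (df y)) ->
  (forall y, 0 <= y -> 0 <= df y) -> 0 <= x -> f 0 <= f x.
Proof.
move=> fdf df0 x0.
have [|c cx fE] := @MVT_segment R f df 0 x x0.
  by apply: derivable_within_continuous => y _; apply: ex_derive.
rewrite -subr_ge0 fE subr0 mulr_ge0// df0//.
by move: cx; rewrite in_itv/= => /andP[].
Qed.

Lemma sinh_ge0 y : 0 <= y -> 0 <= sinh y.
Proof. by move=> y0; rewrite divr_ge0// subr_ge0 ler_expR; lra. Qed.

Lemma sinh_le_mulcosh y : 0 <= y -> sinh y <= y * cosh y.
Proof.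
move=> y0; rewrite -subr_ge0.
have -> : (0 : R) = 0 * cosh 0 - sinh 0 by rewrite /sinh oppr0 subrr !mul0r subrr.
apply: (@le_at0_of_derive_ge0 (fun y => y * cosh y - sinh y) (fun y => y * sinh y)).
- move=> z; have := is_derive_cosh z; have := is_derive_sinh z => ? ?.
  by apply: is_derive_eq; rewrite /GRing.scale/=; lra.
- by move=> z z0; rewrite mulr_ge0// sinh_ge0.
- by [].
Qed.

(** Differentiating sinh - (y - y^3/3) cosh leaves y (y cosh - sinh) plus a
    nonnegative term, so everything rests on sinh_le_mulcosh.  Working with sinh
    and cosh instead of tanh keeps all the derivatives polynomial in them. *)
Lemma sinh_ge_cubic y : 0 <= y -> (y - y ^+ 3 / 3) * cosh y <= sinh y.
Proof.
move=> y0; rewrite -subr_ge0.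
have {1}-> : (0 : R) = sinh 0 - (0 - 0 ^+ 3 / 3) * cosh 0.
  by rewrite /sinh oppr0; field.
apply: (@le_at0_of_derive_ge0 (fun y => sinh y - (y - y ^+ 3 / 3) * cosh y)
  (fun y => y * (y * cosh y - sinh y) + y ^+ 3 / 3 * sinh y)).
- move=> z; have := is_derive_cosh z; have := is_derive_sinh z => ? ?.
  by apply: is_derive_eq; rewrite /GRing.scale/=; field.
- move=> z z0; apply: addr_ge0.
    by rewrite mulr_ge0// subr_ge0 sinh_le_mulcosh.
  by apply: mulr_ge0; [rewrite divr_ge0 ?exprn_ge0|exact: sinh_ge0].
- by [].
Qed.

(** This is tanh y <= y - y^3 / (3 (1 + y^2)) cleared of denominators.  Unlike
    the Taylor bound of order five it stays below y for large y, which later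
    gives a bound valid for all y at once. *)
Lemma sinh_le_rational y : 0 <= y ->
  3 * (1 + y ^+ 2) * sinh y <= (3 * y + 2 * y ^+ 3) * cosh y.
Proof.
move=> y0; rewrite -subr_ge0.
have {1}-> : (0 : R) = (3 * 0 + 2 * 0 ^+ 3) * cosh 0 - 3 * (1 + 0 ^+ 2) * sinh 0.
  by rewrite /sinh oppr0; field.
apply: (@le_at0_of_derive_ge0 (fun y => (3 * y + 2 * y ^+ 3) * cosh y - 3 * (1 + y ^+ 2) * sinh y)
  (fun y => y * (3 * (y * cosh y - sinh y) + 2 * y ^+ 2 * sinh y))).
- move=> z; have := is_derive_cosh z; have := is_derive_sinh z => ? ?.
  by apply: is_derive_eq; rewrite /GRing.scale/=; ring.
- move=> z z0; apply: mulr_ge0 => //; apply: addr_ge0.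
    by rewrite mulr_ge0// subr_ge0 sinh_le_mulcosh.
  by apply: mulr_ge0; [rewrite mulr_ge0 ?exprn_ge0|exact: sinh_ge0].
- by [].
Qed.

Lemma cosh0 : cosh 0 = 1 :> R.
Proof. by rewrite /cosh oppr0 expR0; lra. Qed.

(** The logarithmic derivative of cosh y * exp (y^4/12 - y^2/2) is
    tanh y - (y - y^3/3). *)
Let cosh_gauss_ge_pos y : 0 <= y ->
  expR (- (y ^+ 4 / 12)) <= cosh y * expR (- (y ^+ 2 / 2)).
Proof.
move=> y0.
suff : 1 <= cosh y * expR (y ^+ 4 / 12 - y ^+ 2 / 2).
  by rewrite expRD mulrCA -ler_pdivrMl ?expR_gt0// mulr1 -expRN.
have {1}-> : 1 = cosh 0 * expR ((0 : R) ^+ 4 / 12 - 0 ^+ 2 / 2).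
  by rewrite cosh0 !expr0n/= !mul0r subrr expR0 mulr1.
apply: (@le_at0_of_derive_ge0 (fun y => cosh y * expR (y ^+ 4 / 12 - y ^+ 2 / 2))
 (fun y => (sinh y - (y - y ^+ 3 / 3) * cosh y) * expR (y ^+ 4 / 12 - y ^+ 2 / 2))) => //.
- move=> z; have := is_derive_cosh z; have := is_derive_sinh z => ? ?.
  by apply: is_derive_eq; rewrite /GRing.scale/=; field.
- by move=> z z0; rewrite mulr_ge0 ?expR_ge0// subr_ge0 sinh_ge_cubic.
Qed.

(** Here the derivative of y^4 / (12 (1 + y^2)) is y^3 (2 + y^2) / (6 (1 + y^2)^2),
    which is at most y^3 / (3 (1 + y^2)). *)
Let cosh_gauss_le_pos y : 0 <= y ->
  cosh y * expR (- (y ^+ 2 / 2)) <= expR (- (y ^+ 4 / (12 * (1 + y ^+ 2)))).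
Proof.
move=> y0.
have p z : 12 * (1 + z ^+ 2) != 0 :> R by rewrite gt_eqF//; nra.
suff : - 1 <= - (cosh y * expR (y ^+ 4 / (12 * (1 + y ^+ 2)) - y ^+ 2 / 2)).
  by rewrite lerN2 expRD mulrCA -ler_pdivlMl ?expR_gt0// mulr1 -expRN.
have {1}-> : 1 = cosh 0 * expR ((0 : R) ^+ 4 / (12 * (1 + 0 ^+ 2)) - 0 ^+ 2 / 2).
  by rewrite cosh0 !expr0n/= !mul0r subrr expR0 mulr1.
apply: (@le_at0_of_derive_ge0
 (fun y => - (cosh y * expR (y ^+ 4 / (12 * (1 + y ^+ 2)) - y ^+ 2 / 2)))
 (fun y => ((y - y ^+ 3 * (2 + y ^+ 2) / (6 * (1 + y ^+ 2) ^+ 2)) * cosh y - sinh y)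
     * expR (y ^+ 4 / (12 * (1 + y ^+ 2)) - y ^+ 2 / 2))) => //.
- move=> z; have := is_derive_cosh z; have := is_derive_sinh z => ? ?.
  have dV : is_derive z 1 (fun y => (12 * (1 + y ^+ 2))^-1) (- (24 * z) / (12 * (1 + z ^+ 2)) ^+ 2).
    have dD : is_derive z 1 (fun y => 12 * (1 + y ^+ 2)) (24 * z).
      by apply: is_derive_eq; rewrite /GRing.scale/=; ring.
    apply: (is_derive_eq (@is_deriveV R (fun y => 12 * (1 + y ^+ 2)) z (24 * z) 1 (p z) dD)).
    by rewrite /GRing.scale/= mulNr mulrC mulNr.
  apply: is_derive_eq; rewrite /GRing.scale/=.
  set e := expR _; field; have := p z; rewrite mulf_eq0 negb_or => /andP[_ ->].
  by [].
- move=> z z0; apply: mulr_ge0; last exact: expR_ge0.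
  have t0 : 0 < 1 + z ^+ 2 by nra.
  have t1 : 0 < 6 * (1 + z ^+ 2) ^+ 2 by rewrite mulr_gt0// exprn_gt0.
  rewrite -(pmulr_rge0 _ t1).
  have -> : 6 * (1 + z ^+ 2) ^+ 2 *
      ((z - z ^+ 3 * (2 + z ^+ 2) / (6 * (1 + z ^+ 2) ^+ 2)) * cosh z - sinh z) =
    2 * (1 + z ^+ 2) * ((3 * z + 2 * z ^+ 3) * cosh z - 3 * (1 + z ^+ 2) * sinh z)
    + z ^+ 5 * cosh z.
    by field; rewrite gt_eqF.
  apply: addr_ge0.
    by rewrite mulr_ge0 ?subr_ge0 ?sinh_le_rational// mulr_ge0// ltW.
  by rewrite mulr_ge0 ?exprn_ge0// ltW// cosh_gt0.
Qed.

(** The lower bound carries no remainder: the Taylor polynomial of order four of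
    ln (cosh y) - y^2/2 is a global minorant. *)
Lemma cosh_gauss_ge y :
  expR (- (y ^+ 4 / 12)) <= cosh y * expR (- (y ^+ 2 / 2)).
Proof.
have [y0|y0] := leP 0 y; first exact: cosh_gauss_ge_pos.
have e4 : (- y) ^+ 4 = y ^+ 4 by ring.
by have := @cosh_gauss_ge_pos (- y); rewrite coshN sqrrN e4; apply; lra.
Qed.

(** One inequality with two uses: it is quartic near 0 with the sharp constant
    1/12, hence gives the limit, and quadratic at infinity, hence gives the
    domination. *)
Lemma cosh_gauss_le y :
  cosh y * expR (- (y ^+ 2 / 2)) <= expR (- (y ^+ 4 / (12 * (1 + y ^+ 2)))).
Proof.
have [y0|y0] := leP 0 y; first exact: cosh_gauss_le_pos.
have e4 : (- y) ^+ 4 = y ^+ 4 by ring.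
by have := @cosh_gauss_le_pos (- y); rewrite coshN sqrrN e4; apply; lra.
Qed.

End hyperbolic.

(** * Integration against the n-fold product and the weak law of large numbers *)

Section power_integral.
Local Open Scope ereal_scope.
Context {d : measure_display} {T : measurableType d} {R : realType}.
Variable rho : probability T R.

Lemma integral_power_prob0 (h : 0.-tuple T -> \bar R) :
  \int[power_prob rho 0]_x h x = h [tuple].
Proof.
rewrite (_ : h = cst (h [tuple])); last by apply/funext => x; rewrite [x]tuple0.
by rewrite integral_cst//= diracT mule1.
Qed.

Lemma integral_power_probS n (h : n.+1.-tuple T -> \bar R) :
  measurable_fun setT h -> (forall x, 0 <= h x) ->
  \int[power_prob rho n.+1]_x h x =
  \int[rho]_a \int[power_prob rho n]_x h (tuple_cons (a, x)).
Proof.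
move=> mh h0.
rewrite /= ge0_integral_distribution//= fubini_tonelli1//=.
by apply: measurableT_comp.
Qed.

Lemma measurable_integral_power_probS n (h : n.+1.-tuple T -> \bar R) :
  measurable_fun setT h -> (forall x, 0 <= h x) ->
  measurable_fun setT (fun a => \int[power_prob rho n]_x h (tuple_cons (a, x))).
Proof.
move=> mh h0.
apply: (measurable_fun_fubini_tonelli_F (fun p => h (tuple_cons p))) => //.
exact: measurableT_comp.
Qed.

Lemma measurable_comp_tuple_cons n a (h : n.+1.-tuple T -> \bar R) :
  measurable_fun setT h ->
  measurable_fun setT (fun x => h (tuple_cons (a, x))).
Proof.
move=> mh; apply: measurableT_comp => //.
exact: measurableT_comp.
Qed.

Lemma sum_tuple_cons (g : T -> R) n a (x : n.-tuple T) :
  (\sum_(i < n.+1) g (tnth (tuple_cons (a, x)) i) =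
   g a + \sum_(i < n) g (tnth x i))%R.
Proof.
rewrite big_ord_recl tnth0; congr (_ + _)%R.
by apply: eq_bigr => i _; rewrite tnthS.
Qed.

Lemma measurable_sum_tnth (g : T -> R) n : measurable_fun setT g ->
  measurable_fun setT (fun x : n.-tuple T => \sum_(i < n) g (tnth x i))%R.
Proof.
move=> mg; apply: measurable_sum => i.
by apply: measurableT_comp => //; exact: measurable_tnth.
Qed.

Lemma integral_sum_tnth (g : T -> R) n :
  measurable_fun setT g -> (forall t, 0 <= g t)%R ->
  \int[power_prob rho n]_x (\sum_(i < n) g (tnth x i))%:E =
  n%:R%:E * \int[rho]_t (g t)%:E.
Proof.
move=> mg g0; elim: n => [|n IH].
  by rewrite integral_power_prob0 big_ord0 mul0e.
rewrite integral_power_probS; last 2 first.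
- by apply/measurable_EFinP; exact: measurable_sum_tnth.
- by move=> x; rewrite lee_fin sumr_ge0.
have mgn : measurable_fun setT (fun x : n.-tuple T => (\sum_(i < n) g (tnth x i))%:E).
  by apply/measurable_EFinP; exact: measurable_sum_tnth.
under eq_integral => a _.
  under eq_integral => x _ do rewrite sum_tuple_cons EFinD.
  rewrite ge0_integralD//=; last first.
  - by move=> x _; rewrite lee_fin sumr_ge0.
  - by move=> x _; rewrite lee_fin.
  rewrite integral_cst//= probability_setT mule1 IH; over.
rewrite ge0_integralD//=; last first.
- by move=> t _; rewrite mule_ge0// integral_ge0// => s _; rewrite lee_fin.
- exact/measurable_EFinP.
- by move=> x _; rewrite lee_fin.
rewrite integral_cst//= probability_setT mule1.
by rewrite -natr1 addrC EFinD ge0_muleDl// ?mul1e// lee_fin.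
Qed.

(** The variance bound for a centred bounded h.  The shift b makes the induction
    close: integrating all coordinates but one with the first value absorbed in
    b, no integral of a cross term between coordinates is ever needed. *)
Lemma integral_sqr_sum_tnth (h : T -> R) (c b : R) n :
  measurable_fun setT h -> (forall t, `|h t| <= c)%R ->
  \int[rho]_t (h t)%:E = 0 ->
  \int[power_prob rho n]_x ((b + \sum_(i < n) h (tnth x i)) ^+ 2)%:E <=
  (b ^+ 2 + n%:R * c ^+ 2)%:E.
Proof.
move=> mh hc h0; elim: n b => [|n IH] b.
  by rewrite integral_power_prob0 big_ord0 mul0r !addr0.
have mf m b' : measurable_fun setT
    (fun x : m.-tuple T => ((b' + \sum_(i < m) h (tnth x i)) ^+ 2)%:E).
  apply/measurable_EFinP; apply: measurable_funX.
  by apply: measurable_funD => //; exact: measurable_sum_tnth.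
rewrite integral_power_probS//; last by move=> x; rewrite lee_fin sqr_ge0.
have mh1 : rho.-integrable setT (EFin \o h).
  apply: measurable_bounded_integrable => //.
    by rewrite -ge0_fin_numE// fin_num_measure.
  exists c; split; first exact: num_real.
  by move=> y cy t _; exact: le_trans (hc t) (ltW cy).
have mh2 : rho.-integrable setT (EFin \o (fun t => (h t)^+2)%R).
  apply: measurable_bounded_integrable => //.
  - by rewrite -ge0_fin_numE// fin_num_measure.
  - exact: measurable_funX.
  exists (c ^+ 2)%R; split; first exact: num_real.
  move=> y cy t _; apply: le_trans (ltW cy) => /=.
  by rewrite normrX lerXn2r ?nnegrE// (le_trans _ (hc t)).
pose H := fun a => (b ^+ 2 + n%:R * c ^+ 2)%:E + ((2 * b)%:E * (h a)%:E + (h a ^+ 2)%:E).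
have HE a : ((b + h a) ^+ 2 + n%:R * c ^+ 2)%:E = H a.
  by rewrite /H -!EFinM -!EFinD; congr EFin; ring.
apply: (@le_trans _ _ (\int[rho]_a H a)).
  apply: ge0_le_integral => //.
  - by move=> a _; apply: integral_ge0 => x _; rewrite lee_fin sqr_ge0.
  - apply: (@measurable_integral_power_probS n
      (fun x => ((b + \sum_(i < n.+1) h (tnth x i)) ^+ 2)%:E)) => // x.
    by rewrite lee_fin sqr_ge0.
  - rewrite (_ : H = fun a => ((b + h a) ^+ 2 + n%:R * c ^+ 2)%:E); last first.
      by apply/funext => a; rewrite HE.
    by apply/measurable_EFinP/measurable_funD => //; apply: measurable_funX; apply: measurable_funD.
  - move=> a _; rewrite -HE (le_trans _ (IH _))//.
    by under eq_integral do rewrite sum_tuple_cons addrA.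
rewrite integralD//=; last 2 first.
- exact: finite_measure_integrable_cst.
- apply: integrableD => //; exact: integrableZl.
rewrite integral_cst//= probability_setT mule1.
rewrite integralD//=; last exact: integrableZl.
rewrite integralZl//= h0 mule0 add0e.
apply: (@le_trans _ _ ((b ^+ 2 + n%:R * c ^+ 2)%:E + \int[rho]_t (c ^+ 2)%:E)).
  rewrite leeD2l//; apply: ge0_le_integral => //.
  - by move=> t _; rewrite lee_fin sqr_ge0.
  - by apply/measurable_EFinP; exact: measurable_funX.
  - move=> t _; rewrite lee_fin -real_normK ?num_real//.
    by rewrite lerXn2r ?nnegrE// (le_trans _ (hc t)).
rewrite integral_cst//= probability_setT mule1 -EFinD lee_fin.
rewrite -natr1; lra.
Qed.

Lemma truncated_integral (g : T -> R) (e : R) :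
  measurable_fun setT g -> (forall t, 0 <= g t)%R ->
  \int[rho]_t (g t)%:E < +oo -> (0 < e)%R ->
  exists k : nat, \int[rho]_t (g t)%:E <=
                  \int[rho]_t (Num.min (g t) k%:R)%:E + e%:E.
Proof.
move=> mg g0 ig e0.
have mgk k : measurable_fun setT (fun t => Num.min (g t) k%:R)%R.
  exact: measurable_minr.
have gi : rho.-integrable setT (EFin \o g).
  apply/integrableP; split; first exact/measurable_EFinP.
  by under eq_integral do rewrite /= ger0_norm//.
have := @dominated_cvg _ _ _ rho setT measurableT
  (fun k t => (Num.min (g t) k%:R)%:E) (EFin \o g) (EFin \o g).
have H1 t : (Num.min (g t) k%:R)%:E @[k --> \oo] --> (EFin \o g) t.
  apply: cvg_near_cst; near=> k; congr EFin; apply/min_idPl.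
  near: k; exact: nbhs_infty_ger.
have H2 k t : `|(Num.min (g t) k%:R)%:E| <= (EFin \o g) t.
  by rewrite /= ger0_norm ?lee_fin ?ge_min ?lexx// le_min g0 ler0n.
move=> /(_ _ _ _ gi) H.
have {}H : \int[rho]_t (Num.min (g t) k%:R)%:E @[k --> \oo] --> \int[rho]_t (g t)%:E.
  by apply: H => //; move=> k; exact/measurable_EFinP.
have fg : \int[rho]_t (g t)%:E \is a fin_num by exact: (integrable_fin_num _ gi).
have fk k : \int[rho]_t (Num.min (g t) k%:R)%:E \is a fin_num.
  rewrite ge0_fin_numE; last first.
    by apply: integral_ge0 => t _; rewrite lee_fin le_min g0 ler0n.
  apply: le_lt_trans ig; apply: ge0_le_integral => //.
  - by move=> t _; rewrite lee_fin le_min g0 ler0n.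
  - exact/measurable_EFinP.
  - exact/measurable_EFinP.
  - by move=> t _; rewrite lee_fin ge_min lexx.
move: H; rewrite -(fineK fg) => /fine_cvg.
move=> /(@cvgr_gt R _ \oo _ _ _) /(_ (fine (\int[rho]_t (g t)%:E) - e)%R).
rewrite gtrBl => /(_ e0) [k _ /(_ k (leqnn k)) /= Hk].
by exists k; rewrite -(fineK (fk k)) -EFinD lee_fin -lerBlDr ltW.
Unshelve. all: by end_near. Qed.

(** The weak law in L^1 for a nonnegative integrable g.  Truncating g at k costs
    at most twice the integral of g - min (g, k), and the truncated sum has
    variance of order k^2 n.  Truncating is what gives access to the fourth
    powers, whose variance may be infinite. *)
Lemma weak_law (g : T -> R) (e : R) :
  measurable_fun setT g -> (forall t, 0 <= g t)%R ->
  \int[rho]_t (g t)%:E < +oo -> (0 < e)%R ->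
  \forall n \near \oo,
    \int[power_prob rho n]_x
      (`|(\sum_(i < n) g (tnth x i)) / n%:R - fine (\int[rho]_t (g t)%:E)|)%:E
    <= e%:E.
Proof.
move=> mg g0 ig e0; set m := fine _.
have fg : \int[rho]_t (g t)%:E = m%:E.
  rewrite fineK// ge0_fin_numE// integral_ge0// => t _; rewrite lee_fin//.
pose dl := (e / 4)%R; have d0 : (0 < dl)%R by rewrite divr_gt0.
have [k] := truncated_integral mg g0 ig d0.
pose gk t := Num.min (g t) k%:R.
have gk0 t : (0 <= gk t)%R by rewrite le_min g0 ler0n.
have gkg t : (gk t <= g t)%R by rewrite ge_min lexx.
have gkk t : (gk t <= k%:R)%R by rewrite ge_min lexx orbT.
have mgk : measurable_fun setT gk by exact: measurable_minr.
rewrite -[X in _ <= X + _]/(\int[rho]_t (gk t)%:E) => kd.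
have fgk0 : \int[rho]_t (gk t)%:E <= m%:E.
  rewrite -fg; apply: ge0_le_integral => //.
  - by move=> t _; rewrite lee_fin.
  - exact/measurable_EFinP.
  - exact/measurable_EFinP.
  - by move=> t _; rewrite lee_fin.
have gki : rho.-integrable setT (EFin \o gk).
  apply/integrableP; split; first exact/measurable_EFinP.
  under eq_integral do rewrite /= ger0_norm//.
  by rewrite (le_lt_trans fgk0)// ltry.
pose mk := fine (\int[rho]_t (gk t)%:E).
have fgk : \int[rho]_t (gk t)%:E = mk%:E.
  by rewrite fineK//; exact: (integrable_fin_num _ gki).
have mkm : (mk <= m)%R by rewrite -lee_fin -fgk.
have mkd : (m - mk <= dl)%R.
  by move: kd; rewrite fg fgk -EFinD lee_fin; lra.
have mk0 : (0 <= mk)%R.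
  by rewrite fine_ge0// integral_ge0// => t _; rewrite lee_fin.
have mkk : (mk <= k%:R)%R.
  rewrite -lee_fin -fgk -[leRHS]mule1 -(@probability_setT _ _ _ rho) -integral_cst//.
  apply: ge0_le_integral => //.
  - by move=> t _; rewrite lee_fin.
  - exact/measurable_EFinP.
  - by move=> t _; rewrite lee_fin.
pose h t := (gk t - mk)%R.
have mh : measurable_fun setT h by exact: measurable_funB.
have hk t : (`|h t| <= k%:R)%R.
  have := gk0 t; have := gkk t; rewrite ler_norml /h; lra.
have ih : \int[rho]_t (h t)%:E = 0.
  rewrite /h; under eq_integral do rewrite EFinB.
  rewrite integralB//=; last exact: finite_measure_integrable_cst.
  by rewrite fgk integral_cst//= probability_setT mule1 subee.
near=> n.
have n0 : (0 < n)%N by near: n; exists 1%N.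
have nR : (0 < n%:R :> R)%R by rewrite ltr0n.
have nk : (k%:R ^+ 2 / (n%:R * dl) <= dl)%R.
  have : (k%:R ^+ 2 / dl ^+ 2 <= n%:R)%R by near: n; exact: nbhs_infty_ger.
  rewrite ler_pdivrMr ?exprn_gt0// => kn.
  by rewrite ler_pdivrMr ?mulr_gt0//; nra.
pose f0 (x : n.-tuple T) := (\sum_(i < n) (g (tnth x i) - gk (tnth x i)))%R.
pose f1 (x : n.-tuple T) := ((0 + \sum_(i < n) h (tnth x i)) ^+ 2)%R.
have mf0 : measurable_fun setT f0.
  by apply: (@measurable_sum_tnth (fun t => (g t - gk t)%R)); exact: measurable_funB.
have mf1 : measurable_fun setT f1.
  by apply/measurable_funX/measurable_funD => //; exact: measurable_sum_tnth.
have f00 x : (0 <= f0 x)%R by apply: sumr_ge0 => i _; rewrite subr_ge0.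
have f10 x : (0 <= f1 x)%R by exact: sqr_ge0.
apply: (@le_trans _ _ (\int[power_prob rho n]_x
  (((2 * dl)%:E + (n%:R^-1)%:E * (f0 x)%:E) + ((n%:R ^+ 2 * dl)^-1)%:E * (f1 x)%:E))).
  apply: ge0_le_integral => //.
  - apply/measurable_EFinP; apply: measurableT_comp => //; apply: measurable_funB => //.
    by apply: measurable_funM => //; exact: measurable_sum_tnth.
  - by rewrite /=; do ?apply: emeasurable_funD => //; apply: measurable_funeM;
      exact/measurable_EFinP.
  - move=> x _; rewrite -!EFinM -!EFinD lee_fin.
    have hE : (\sum_(i < n) h (tnth x i) = \sum_(i < n) gk (tnth x i) - n%:R * mk)%R.
      by rewrite sumrB sumr_const card_ord mulr_natl.
    rewrite /f1 /f0 hE sumrB add0r.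
    set A := (\sum_(i < n) g _)%R; set B := (\sum_(i < n) gk _)%R.
    have AB : (B <= A)%R by apply: ler_sum.
    pose y := (B / n%:R - mk)%R.
    have -> : ((n%:R ^+ 2 * dl)^-1 * (B - n%:R * mk) ^+ 2 = y ^+ 2 / dl)%R.
      by rewrite /y; field; rewrite !gt_eqF.
    have -> : (A / n%:R - m = n%:R^-1 * (A - B) - (m - mk) + y)%R by rewrite /y; ring.
    have : (0 <= n%:R^-1 * (A - B))%R by rewrite mulr_ge0// subr_ge0.
    (* Replaces Cauchy-Schwarz: the first moment is bounded by the second. *)
    have : (`|y| <= dl + y ^+ 2 / dl)%R.
      rewrite -(ler_pM2r d0) mulrDl divfK ?gt_eqF//.
      by have := real_normK (num_real y); have := normr_ge0 y; nra.
    move=> Hy HAB; rewrite (le_trans (ler_normD _ _))//.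
    rewrite (le_trans (lerD (ler_normB _ _) (lexx _)))//.
    rewrite (ger0_norm HAB) (@ger0_norm _ (m - mk)%R) ?subr_ge0//.
    by move: Hy mkd; set a := (n%:R^-1 * _)%R; lra.
rewrite ge0_integralD//=; last 4 first.
- by move=> x _; rewrite -!EFinM -EFinD lee_fin addr_ge0 ?mulr_ge0// ltW.
- by apply: emeasurable_funD => //; apply: measurable_funeM; exact/measurable_EFinP.
- by move=> x _; rewrite -!EFinM lee_fin mulr_ge0// invr_ge0 mulr_ge0 ?exprn_ge0// ltW.
- by apply: measurable_funeM; exact/measurable_EFinP.
rewrite ge0_integralD//=; last 3 first.
- by move=> x _; rewrite lee_fin mulr_ge0// ltW.
- by move=> x _; rewrite -!EFinM lee_fin mulr_ge0.
- by apply: measurable_funeM; exact/measurable_EFinP.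
rewrite integral_cst//= probability_setT mule1.
rewrite !ge0_integralZl//; last 5 first.
- exact/measurable_EFinP.
- by move=> x _; rewrite lee_fin.
- by rewrite lee_fin invr_ge0 mulr_ge0 ?exprn_ge0// ltW.
- exact/measurable_EFinP.
- by move=> x _; rewrite lee_fin.
have -> : \int[power_prob rho n]_x (f0 x)%:E = n%:R%:E * (m - mk)%:E.
  rewrite (@integral_sum_tnth (fun t => (g t - gk t)%R)).
  - congr (_ * _); under eq_integral do rewrite EFinB.
    rewrite integralB//=; first by rewrite fg fgk.
    apply/integrableP; split; first exact/measurable_EFinP.
    by under eq_integral do rewrite /= ger0_norm//.
  - exact: measurable_funB.
  - by move=> t; rewrite subr_ge0.
apply: (@le_trans _ _ ((2 * dl)%:E + dl%:E + dl%:E)).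
  apply: leeD; first apply: leeD => //.
    by rewrite -!EFinM mulrA mulVf ?mul1r ?lee_fin// gt_eqF.
  apply: (@le_trans _ _ (((n%:R ^+ 2 * dl)^-1)%:E * (0 ^+ 2 + n%:R * k%:R ^+ 2)%:E)).
    apply: lee_wpmul2l; first by rewrite lee_fin invr_ge0 mulr_ge0 ?exprn_ge0// ltW.
    exact: integral_sqr_sum_tnth.
  rewrite -EFinM lee_fin (le_trans _ nk)// le_eqVlt; apply/orP; left; apply/eqP.
  by field; rewrite !gt_eqF.
by rewrite -!EFinD lee_fin /dl; lra.
Unshelve. all: end_near. Qed.

End power_integral.

(** * Symmetrization of exponential weights *)

Section symmetrization.
Local Open Scope ereal_scope.
Context {R : realType}.
Variable rho : probability R R.
Hypothesis rho_symmetric : forall A : set R, measurable A ->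
       pushforward rho (-%R : R -> R) A = rho A.

Lemma integral_opp (h : R -> \bar R) : measurable_fun setT h ->
  (forall t, 0 <= h t) -> \int[rho]_t h (- t)%R = \int[rho]_t h t.
Proof.
move=> mh h0.
have mN : measurable_fun setT (-%R : R -> R) by exact: measurable_funN.
rewrite -[LHS](@ge0_integral_pushforward _ _ _ _ _ (-%R : R -> R) mN rho setT h)//.
by apply: eq_measure_integral => A mA _; exact: rho_symmetric.
Qed.

Lemma integral_even_part (h : R -> \bar R) : measurable_fun setT h ->
  (forall t, 0 <= h t) ->
  \int[rho]_t h t = \int[rho]_t ((2^-1)%:E * (h t + h (- t)%R)).
Proof.
move=> mh h0.
have mhN : measurable_fun setT (fun t : R => h (- t)%R).
  by apply: measurableT_comp.
rewrite ge0_integralZl//; last 2 first.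
- exact: emeasurable_funD.
- by move=> t _; rewrite adde_ge0.
rewrite ge0_integralD// integral_opp//.
rewrite ge0_muleDr ?integral_ge0// -ge0_muleDl ?lee_fin// -EFinD.
by rewrite (_ : 2^-1 + 2^-1 = 1)%R ?mul1e//; lra.
Qed.

Lemma measurable_sumS n : measurable_fun setT (@sumS R n).
Proof. by apply: measurable_sum => i; exact: measurable_tnth. Qed.

Lemma measurable_sumT n : measurable_fun setT (@sumT R n).
Proof.
by apply: measurable_sum => i; apply: measurable_funX; exact: measurable_tnth.
Qed.

Lemma measurable_cosh : measurable_fun setT (@cosh R).
Proof.
apply: continuous_measurable_fun => x.
by apply/differentiable_continuous/derivable1_diffP; case: (is_derive_cosh x).
Qed.

Lemma measurable_prod_cosh n (th : R -> R) : measurable_fun setT th ->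
  measurable_fun setT (fun x : n.-tuple R =>
    \prod_(i < n) cosh (th (sumT x) * tnth x i))%R.
Proof.
move=> mth; apply: measurable_prod => i _.
apply: (measurableT_comp measurable_cosh); apply: measurable_funM.
  by apply: measurableT_comp => //; exact: measurable_sumT.
exact: measurable_tnth.
Qed.

Lemma prod_cosh_ge0 n (a : R) (x : n.-tuple R) :
  (0 <= \prod_(i < n) cosh (a * tnth x i))%R.
Proof. by apply: prodr_ge0 => i _; rewrite ltW// cosh_gt0. Qed.

Lemma sumT_cons n (a : R) (x : n.-tuple R) :
  (sumT (tuple_cons (a, x)) = a ^+ 2 + sumT x)%R.
Proof. by rewrite /sumT (@sum_tuple_cons _ R R (fun t => (t ^+ 2)%R)). Qed.

Lemma sumS_cons n (a : R) (x : n.-tuple R) :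
  (sumS (tuple_cons (a, x)) = a + sumS x)%R.
Proof. by rewrite /sumS (@sum_tuple_cons _ R R id). Qed.

(** Given the absolute values of the coordinates the signs are independent and
    fair, so each factor exp (th * x_i) averages to cosh (th * x_i); this is
    legitimate since th depends on x through sumT x only.  The induction
    integrates the first coordinate a last: with a fixed, psi and th become the
    shifted functions of t := a^2 + sumT x, so the hypothesis applies to them. *)
Lemma integral_symmetrize n (psi th : R -> R) :
  measurable_fun setT psi -> measurable_fun setT th -> (forall t, 0 <= psi t)%R ->
  \int[power_prob rho n]_x (psi (sumT x) * expR (th (sumT x) * sumS x))%:E =
  \int[power_prob rho n]_x
     (psi (sumT x) * \prod_(i < n) cosh (th (sumT x) * tnth x i))%:E.
Proof.
elim: n psi th => [|n IH] psi th mpsi mth psi0.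
  by rewrite !integral_power_prob0 big_ord0 /sumS big_ord0 mulr0 expR0.
have mpT m (p : R -> R) : measurable_fun setT p ->
    measurable_fun setT (fun x : m.-tuple R => p (sumT x)).
  by move=> mp; apply: measurableT_comp => //; exact: measurable_sumT.
rewrite integral_power_probS; last 2 first.
- apply/measurable_EFinP; apply: measurable_funM; first exact: mpT.
  apply: measurableT_comp => //; apply: measurable_funM; [exact: mpT|exact: measurable_sumS].
- by move=> x; rewrite lee_fin mulr_ge0// expR_ge0.
rewrite integral_power_probS; last 2 first.
- apply/measurable_EFinP; apply: measurable_funM; first exact: mpT.
  exact: measurable_prod_cosh.
- by move=> x; rewrite lee_fin mulr_ge0// prod_cosh_ge0.
pose K a (x : n.-tuple R) := (psi (a ^+ 2 + sumT x) *
   \prod_(i < n) cosh (th (a ^+ 2 + sumT x) * tnth x i))%R.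
pose H a := \int[power_prob rho n]_x (expR (th (a ^+ 2 + sumT x) * a) * K a x)%:E.
transitivity (\int[rho]_a H a).
  apply: eq_integral => a _.
  have mD (p : R -> R) : measurable_fun setT p -> measurable_fun setT (fun t => p (a ^+ 2 + t)%R).
    by move=> mp; apply: measurableT_comp => //; exact: measurable_funD.
  pose psia t := (psi (a ^+ 2 + t) * expR (th (a ^+ 2 + t) * a))%R.
  pose tha t := th (a ^+ 2 + t)%R.
  transitivity (\int[power_prob rho n]_x
     (psia (sumT x) * expR (tha (sumT x) * sumS x))%:E).
    apply: eq_integral => x _; congr EFin.
    by rewrite sumT_cons sumS_cons mulrDr expRD mulrA.
  rewrite (IH psia tha).
  - apply: eq_integral => x _; congr EFin.
    by rewrite /K mulrA; congr (_ * _)%R; rewrite mulrC.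
  - apply: measurable_funM; first exact: mD.
    by apply: measurableT_comp => //; apply: measurable_funM => //; exact: mD.
  - exact: mD.
  - by move=> t; rewrite mulr_ge0// expR_ge0.
have K0 a x : (0 <= K a x)%R by rewrite mulr_ge0// prod_cosh_ge0.
pose h (y : n.+1.-tuple R) := (expR (th (sumT y) * tnth y ord0) *
  (psi (sumT y) * \prod_(i < n) cosh (th (sumT y) * tnth y (lift ord0 i))))%:E.
have hE a x : h (tuple_cons (a, x)) = (expR (th (a ^+ 2 + sumT x) * a) * K a x)%:E.
  rewrite /h sumT_cons tnth0 /K; congr (_ * (_ * _))%:E.
  by apply: eq_bigr => i _; rewrite tnthS.
have mh : measurable_fun setT h.
  apply/measurable_EFinP; apply: measurable_funM.
    apply: measurableT_comp => //; apply: measurable_funM; first exact: mpT.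
    exact: measurable_tnth.
  apply: measurable_funM; first exact: mpT.
  apply: measurable_prod => i _.
  apply: (measurableT_comp measurable_cosh); apply: measurable_funM; first exact: mpT.
  exact: measurable_tnth.
have h0 y : 0 <= h y.
  rewrite lee_fin mulr_ge0 ?expR_ge0// mulr_ge0//.
  by apply: prodr_ge0 => i _; rewrite ltW// cosh_gt0.
have HE : H = fun a => \int[power_prob rho n]_x h (tuple_cons (a, x)).
  by apply/funext => a; apply: eq_integral => x _; rewrite hE.
have mH : measurable_fun setT H.
  by rewrite HE; exact: measurable_integral_power_probS.
have H0 a : 0 <= H a.
  by apply: integral_ge0 => x _; rewrite lee_fin mulr_ge0// expR_ge0.
rewrite (integral_even_part mH H0).
apply: eq_integral => a _.
have HNE : H (- a)%R = \int[power_prob rho n]_x (expR (th (a ^+ 2 + sumT x) * - a) * K a x)%:E.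
  by apply: eq_integral => x _; rewrite /K sqrrN.
have mp : measurable_fun setT
    (fun x : n.-tuple R => (expR (th (a ^+ 2 + sumT x) * a) * K a x)%:E).
  rewrite (_ : (fun x => _) = fun x => h (tuple_cons (a, x))).
    exact: measurable_comp_tuple_cons.
  by apply/funext => x; rewrite hE.
have mn : measurable_fun setT
    (fun x : n.-tuple R => (expR (th (a ^+ 2 + sumT x) * - a) * K a x)%:E).
  rewrite (_ : (fun x => _) = fun x => h (tuple_cons (- a, x)%R)).
    exact: measurable_comp_tuple_cons.
  by apply/funext => x; rewrite hE /K sqrrN.
rewrite HNE [H a]/H; clear HNE HE mH H0 H hE mh h0 h.
rewrite -ge0_integralD//; last 2 first.
- by move=> x _; rewrite lee_fin mulr_ge0// expR_ge0.
- by move=> x _; rewrite lee_fin mulr_ge0// expR_ge0.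
rewrite -ge0_integralZl//; last 2 first.
- exact: emeasurable_funD.
- by move=> x _; rewrite adde_ge0// lee_fin mulr_ge0// expR_ge0.
apply: eq_integral => x _.
rewrite -EFinD -EFinM sumT_cons big_ord_recl tnth0; congr EFin.
under [in RHS]eq_bigr do rewrite tnthS.
by rewrite mulrN /K /cosh; field.
Qed.

End symmetrization.

(** * Measures with a density, Gaussian and quartic integrals *)

Section density.
Local Open Scope ereal_scope.
Context {d : measure_display} {T : measurableType d} {R : realType}.
Variables (mu nu : {measure set T -> \bar R}) (w : T -> R).
Hypotheses (mw : measurable_fun setT w) (w0 : forall x, (0 <= w x)%R).
Hypothesis nuE : forall A, measurable A -> nu A = \int[mu]_(x in A) (w x)%:E.

Import HBNNSimple.

(** Both sides are monotone limits along simple functions, for which the claim is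
    the hypothesis on measurable sets. *)
Lemma integral_density (f : T -> \bar R) : measurable_fun setT f ->
  (forall x, 0 <= f x) -> \int[nu]_x f x = \int[mu]_x (f x * (w x)%:E).
Proof.
move=> mf f0.
pose h := nnsfun_approx measurableT mf.
have -> : \int[nu]_x f x = lim (\int[nu]_x (EFin \o h n) x @[n --> \oo]).
  have fE x : f x = lim ((EFin \o h n) x @[n --> \oo]).
    by apply/esym/cvg_lim => //; exact: cvg_nnsfun_approx.
  under eq_integral => x _ do rewrite fE.
  apply: monotone_convergence => //.
  - by move=> n; apply/measurable_EFinP.
  - by move=> n x _ //=; rewrite lee_fin.
  - by move=> x _ a b ab; rewrite lee_fin; exact/lefP/nd_nnsfun_approx.
have -> : \int[mu]_x (f x * (w x)%:E) =
    lim (\int[mu]_x ((EFin \o h n) x * (w x)%:E) @[n --> \oo]).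
  have fg x : f x * (w x)%:E = lim (((EFin \o h n) x * (w x)%:E) @[n --> \oo]).
    by apply/esym/cvg_lim => //; apply: cvgeZr => //; exact: cvg_nnsfun_approx.
  under eq_integral => x _ do rewrite fg.
  apply: monotone_convergence => [//| | |].
  - by move=> n; apply/emeasurable_funM; exact/measurable_EFinP.
  - by move=> n x _ /=; rewrite mule_ge0 ?lee_fin.
  - by move=> x _ a b ab/=; rewrite lee_wpmul2r ?lee_fin//; exact/lefP/nd_nnsfun_approx.
congr (lim (_ @ \oo)); apply/funext => n.
transitivity (\int[nu]_x
   (\sum_(y \in range (h n)) (y * \1_(h n @^-1` [set y]) x)%:E)).
  by apply: eq_integral => t tE; rewrite /= fimfunE -fsumEFin.
rewrite ge0_integral_fsum//; last 2 first.
- by move=> y; apply/measurable_EFinP; exact: measurable_funM.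
- by move=> m y Ey; exact: nnfun_muleindic_ge0.
transitivity (\int[mu]_x (\sum_(y \in range (h n))
    (y * \1_(h n @^-1` [set y]) x)%:E * (w x)%:E)); last first.
  apply: eq_integral => x xE.
  rewrite -ge0_mule_fsuml => [|y]; last exact: nnfun_muleindic_ge0.
  by rewrite fsumEFin // -(fimfunE _ x).
rewrite ge0_integral_fsum//; last 2 first.
- move=> y; apply: emeasurable_funM; last exact/measurable_EFinP.
  by apply/measurable_EFinP; exact: measurable_funM.
- by move=> m y Ey; apply: mule_ge0; [exact: nnfun_muleindic_ge0|rewrite lee_fin].
apply: eq_fsbigr => r rhn.
under [LHS]eq_integral do rewrite EFinM.
rewrite integralZl_indic_nnsfun => //.
under [RHS]eq_integral do rewrite EFinM -muleA.
rewrite ge0_integralZl//.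
- under [in RHS]eq_integral do rewrite muleC.
  rewrite [in RHS](eq_integral ((EFin \o w) \_ (h n @^-1` [set r]))); last first.
    by move=> x xE; rewrite epatch_indic.
  by rewrite -integral_mkcond -nuE// integral_indic// setIT.
- by apply: emeasurable_funM; exact/measurable_EFinP.
- by move=> t Et; rewrite mule_ge0 ?lee_fin.
- by move: rhn; rewrite inE => -[t _ <-]; rewrite lee_fin.
Qed.

End density.

Section density_probability.
Local Open Scope ereal_scope.
Context {R : realType}.
Notation leb := (@lebesgue_measure R).

Lemma density_probability (g : R -> R) : measurable_fun setT g ->
  (forall x, 0 <= g x)%R -> \int[leb]_x (g x)%:E = 1 ->
  exists nu : probability R R, forall A, measurable A ->
    nu A = \int[leb]_(x in A) (g x)%:E.
Proof.
move=> mg g0 g1.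
have ig : leb.-integrable setT (EFin \o g).
  apply/integrableP; split; first exact/measurable_EFinP.
  by under eq_integral do rewrite /= ger0_norm//; rewrite g1 ltry.
pose m (A : set R) := \int[leb]_(x in A) (g x)%:E.
have m0 : m set0 = 0 by rewrite /m integral_set0.
have mge0 A : 0 <= m A by apply: integral_ge0 => x _; rewrite lee_fin.
have msig : semi_sigma_additive m.
  move=> /= A mA tA mUA.
  rewrite /m/= integral_bigcup//=; last first.
    exact: (integrableS _ _ (subsetT _)).
  apply: is_cvg_ereal_nneg_natsum_cond => n _ _.
  by apply: integral_ge0 => /= x ?; rewrite lee_fin.
pose mM := isMeasure.Build _ _ _ m m0 mge0 msig.
pose mm : {measure set R -> \bar R} := HB.pack m mM.
pose mP := @Measure_isProbability.Build _ _ R mm g1.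
pose nu : probability R R := HB.pack (Measure.sort mm) mP.
by exists nu.
Qed.

Lemma measurable_exp_gauss (a m : R) : measurable_fun setT
  (fun s : R => (expR (- (a * (s - m) ^+ 2)))%:E).
Proof.
apply/measurable_EFinP; apply: measurableT_comp => //; apply: measurable_funN.
by apply: measurable_funM => //; apply: measurable_funX; exact: measurable_funB.
Qed.

Lemma integral_gauss_scaled (a m : R) : (0 < a)%R ->
  \int[leb]_s (expR (- (a * (s - m) ^+ 2)))%:E = (Num.sqrt (pi / a))%:E.
Proof.
move=> a0.
pose s := Num.sqrt ((2 * a)^-1)%R.
have a20 : (0 < (2 * a)^-1)%R by rewrite invr_gt0 mulr_gt0.
have s0 : s != 0%R by rewrite gt_eqF// sqrtr_gt0.
have s2 : (s ^+ 2 = (2 * a)^-1)%R by rewrite sqr_sqrtr// ltW.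
have := integral_normal_pdf m s.
under eq_integral => x _.
  rewrite normal_pdfE// EFinM.
  have -> : normal_fun m s x = expR (- (a * (x - m) ^+ 2)).
    by rewrite /normal_fun s2; congr expR; field; rewrite gt_eqF.
  over.
rewrite ge0_integralZl//=; last 2 first.
- exact: measurable_exp_gauss.
- by rewrite lee_fin normal_peak_ge0.
have -> : normal_peak s = ((Num.sqrt (pi / a))^-1)%R.
  rewrite /normal_peak s2; congr ((Num.sqrt _)^-1)%R; field; rewrite gt_eqF//.
have q0 : (0 < Num.sqrt (pi / a))%R by rewrite sqrtr_gt0 divr_gt0// pi_gt0.
move=> H.
have : (Num.sqrt (pi / a))%:E * (((Num.sqrt (pi / a))^-1)%:E *
  \int[leb]_s (expR (- (a * (s - m) ^+ 2)))%:E) = (Num.sqrt (pi / a))%:E.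
  by rewrite H mule1.
by rewrite muleA -EFinM divff ?gt_eqF// mul1e.
Qed.

End density_probability.

Section quartic.
Context {R : realType}.
Notation leb := (@lebesgue_measure R).

Lemma cvg_powR_pinfty (p : R) : 0 < p -> x `^ p @[x --> +oo] --> +oo.
Proof.
move=> p0; apply/cvgryPge => A; near=> x.
have A0 : 0 <= Num.max A 0 by rewrite le_max lexx orbT.
rewrite (@le_trans _ _ (Num.max A 0))// ?le_max ?lexx//.
rewrite -[leLHS]powRr1// -(@mulVf _ p) ?gt_eqF// powRrM.
rewrite ge0_ler_powR ?ltW// ?nnegrE ?powR_ge0//.
Unshelve. all: by end_near. Qed.

Variable k : R.
Hypothesis k0 : 0 < k.
Let c := k `^ (- 4^-1).
(** The substitution s = F x solves k s^4 = x.  It is used in this direction, and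
    not as x = k s^4, because its derivative f has a finite limit at infinity. *)
Let F (x : R) := c * x `^ 4^-1.
Let f (x : R) := c * (4^-1 * x `^ (4^-1 - 1)).

Let c0 : 0 < c. Proof. exact: powR_gt0. Qed.

Let pow4 (x : R) : 0 <= x -> (x `^ 4^-1) ^+ 4 = x.
Proof.
move=> x0; rewrite -powR_mulrn ?powR_ge0// -powRrM mulVf ?powRr1//.
Qed.

Let kF (x : R) : 0 <= x -> k * F x ^+ 4 = x.
Proof.
move=> x0; rewrite /F exprMn pow4// mulrA /c powRN exprVn pow4 ?ltW//.
by rewrite mulfV ?mul1r// gt_eqF.
Qed.

Let dF (x : R) : 0 < x -> is_derive x 1 F (f x).
Proof.
move=> x0; have h := is_derive1_powR (4^-1) x0.
by apply: is_derive_eq.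
Qed.

Let F'E (x : R) : 0 < x -> F^`()%classic x = f x.
Proof. by move=> x0; rewrite derive1E; case: (dF x0). Qed.

Let incrF : {in `[0, +oo[ &, {homo F : x y / x < y}}.
Proof.
move=> x y; rewrite !in_itv/= !andbT => x0 y0 xy.
rewrite ltr_pM2l// gt0_ltr_powR ?nnegrE//.
Qed.

Let continuous_powR_pos (p x : R) : 0 < x -> {for x, continuous (@powR R ^~ p)}.
Proof.
move=> x0; apply/differentiable_continuous/derivable1_diffP.
by have [] := is_derive1_powR p x0.
Qed.

Let continuous_f (x : R) : 0 < x -> {for x, continuous f}.
Proof.
move=> x0; apply: cvgM; first exact: cvg_cst.
by apply: cvgM; [exact: cvg_cst|exact: continuous_powR_pos].
Qed.

Let near_F' (x : R) : 0 < x -> {near x, F^`()%classic =1 f}.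
Proof.
move=> x0; near=> y; apply: F'E; near: y; exact: lt_nbhsr.
Unshelve. all: by end_near. Qed.

Let continuous_F' (x : R) : 0 < x -> {for x, continuous F^`()%classic}.
Proof.
move=> x0.
suff: F^`()%classic @ x --> f x by rewrite -(F'E x0).
apply: cvg_trans (continuous_f x0).
by apply: near_eq_cvg; near do apply/esym; exact: near_F'.
Unshelve. all: by end_near. Qed.

Let cvg_F'_pinfty : (F^`()%classic) x @[x --> +oo] --> 0.
Proof.
have h : f x @[x --> +oo] --> c * (4^-1 * 0).
  apply: cvgM; first exact: cvg_cst.
  apply: cvgM; first exact: cvg_cst.
  rewrite (_ : (fun x => x `^ (4^-1 - 1)) = (fun x : R => (x `^ (3 / 4))^-1)); last first.
    by apply/funext => x; rewrite /= -powRN; congr powR; lra.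
  apply: (iffRL (@gtr0_cvgV0 _ _ _ _ (fun x : R => x `^ (3 / 4)) _)).
    near=> x; apply: powR_gt0; near: x; exact: nbhs_pinfty_gt.
  by apply: cvg_powR_pinfty; lra.
rewrite !mulr0 in h; apply: cvg_trans h; apply: near_eq_cvg.
near=> x; apply/esym/F'E; near: x; exact: nbhs_pinfty_gt.
Unshelve. all: by end_near. Qed.

Let cvg_F_pinfty : F x @[x --> +oo] --> +oo.
Proof. by apply: gt0_cvgMry => //; apply: cvg_powR_pinfty; lra. Qed.

Let G (s : R) := expR (- (k * s ^+ 4)).

Lemma continuous_exp_quartic : continuous G.
Proof.
move=> x; apply: (@continuous_comp _ _ _ (fun s : R => - (k * s ^+ 4)) expR);
  last exact: continuous_expR.
apply: cvgN; apply: cvgM; first exact: cvg_cst.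
exact: exprn_continuous.
Qed.

(** f blows up at 0, so the substitution is done away from 0 and the lower end is
    sent to 0 afterwards. *)
Let tail_eq (a : R) : 0 < a ->
  (\int[leb]_(s in `[F a, +oo[) (G s)%:E =
   \int[leb]_(x in `[a, +oo[) (4^-1 * c * (x `^ (4^-1 - 1) * expR (- x)))%:E)%E.
Proof.
move=> a0.
rewrite (@increasing_ge0_integration_by_substitutiony R F G a).
- apply: eq_integral => x; rewrite inE/= in_itv/= andbT => ax.
  have x0 : 0 < x by exact: lt_le_trans ax.
  congr EFin; rewrite [LHS]/GRing.mul/= F'E// /G kF ?ltW// /f; ring.
- move=> x y; rewrite !in_itv/= !andbT => ax ay xy.
  by apply: incrF; rewrite ?in_itv/= ?andbT ?(le_trans (ltW a0)).
- by move=> x; rewrite in_itv/= andbT => ax; apply: continuous_F'; exact: lt_trans ax.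
- apply/cvg_ex; exists (F^`()%classic a); apply: cvg_at_right_filter; exact: continuous_F'.
- by apply/cvg_ex; exists 0.
- split.
    move=> x; rewrite in_itv/= andbT => ax.
    by have [] := dF (lt_trans a0 ax).
  apply: cvg_at_right_filter.
  by apply/differentiable_continuous/derivable1_diffP; have [] := dF a0.
- exact: cvg_F_pinfty.
- by apply: continuous_subspaceT; exact: continuous_exp_quartic.
- by move=> x _; exact: expR_ge0.
Qed.

Let cvg_tails (h : R -> \bar R) (a : nat -> R) :
  measurable_fun setT h -> (forall x, 0 <= h x)%E ->
  (forall n, 0 < a n) -> (forall m n, (m <= n)%N -> a n <= a m) ->
  (forall x, 0 < x -> exists n, a n <= x) ->
  (\int[leb]_(x in `[a n, +oo[) h x @[n --> \oo] --> \int[leb]_(x in `]0%R, +oo[) h x)%E.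
Proof.
move=> mh h0 a0 ad ax.
have -> : `]0%R, +oo[%classic = \bigcup_n `[a n, +oo[%classic.
  apply/seteqP; split => x /=; rewrite in_itv/= andbT.
    by move=> /ax [n anx]; exists n => //=; rewrite in_itv/= andbT.
  by move=> [n _] /=; rewrite in_itv/= andbT; exact: lt_le_trans.
apply: ge0_nondecreasing_set_cvg_integral => //.
- move=> m n mn; apply/subsetPset => x /=; rewrite !in_itv/= !andbT.
  by apply: le_trans; exact: ad.
- by move=> n; exact: measurable_funTS.
Qed.

Let half_line_eq :
  (\int[leb]_(s in `]0%R, +oo[) (G s)%:E =
   \int[leb]_(x in `]0%R, +oo[) (4^-1 * c * (x `^ (4^-1 - 1) * expR (- x)))%:E)%E.
Proof.
pose a (n : nat) : R := n.+1%:R^-1.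
have a0 n : 0 < a n by rewrite invr_gt0.
have ad m n : (m <= n)%N -> a n <= a m.
  by move=> mn; rewrite /a lef_pV2 ?posrE// ler_nat.
have ax (x : R) : 0 < x -> exists n, a n <= x.
  move=> x0; have [n _ /(_ n (leqnn n))/= h] := near_infty_natSinv_lt (PosNum x0).
  by exists n; rewrite ltW.
have h1 : (\int[leb]_(x in `[F (a n), +oo[) (G x)%:E @[n --> \oo] -->
    \int[leb]_(x in `]0%R, +oo[) (G x)%:E)%E.
  apply: (@cvg_tails (EFin \o G) (F \o a)).
  - apply/measurable_EFinP; apply: continuous_measurable_fun.
    exact: continuous_exp_quartic.
  - by move=> x; rewrite lee_fin expR_ge0.
  - by move=> n; apply: mulr_gt0 => //; exact: powR_gt0.
  - move=> m n mn /=; rewrite ler_pM2l// ge0_ler_powR ?nnegrE ?(ltW (a0 _))//.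
    exact: ad.
  - move=> x x0; have [n an] := ax (k * x ^+ 4) (mulr_gt0 k0 (exprn_gt0 4 x0)).
    exists n => /=.
    have : F (a n) ^+ 4 <= x ^+ 4.
      by rewrite -(ler_pM2l k0) kF// ltW.
    by rewrite ler_pXn2r ?nnegrE ?(ltW x0)//; apply: mulr_ge0; [exact: ltW c0|exact: powR_ge0].
have h2 := @cvg_tails (fun x => (4^-1 * c * (x `^ (4^-1 - 1) * expR (- x)))%:E) a _ _ a0 ad ax.
rewrite -(cvg_lim _ h1)//; apply/cvg_lim => //.
under eq_cvg do rewrite tail_eq//.
apply: h2.
  apply/measurable_EFinP; apply: measurable_funM => //; apply: measurable_funM.
    exact: measurable_powR.
  by apply: measurableT_comp => //; exact: measurable_funN.
by move=> x; rewrite lee_fin !mulr_ge0 ?powR_ge0 ?expR_ge0 ?(ltW c0).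
Qed.

Let measurable_gauss0 := @measurable_exp_gauss R (2 * k) 0.

(** Domination by a Gaussian: k s^4 >= k (2 s^2 - 1). *)
Lemma integral_quartic_lty : (\int[leb]_s (expR (- (k * s ^+ 4)))%:E < +oo)%E.
Proof.
apply: (@le_lt_trans _ _ (\int[leb]_s ((expR k)%:E * (expR (- (2 * k * (s - 0) ^+ 2)))%:E))%E).
  apply: ge0_le_integral => //.
  - apply/measurable_EFinP; apply: continuous_measurable_fun.
    exact: continuous_exp_quartic.
  - exact: measurable_funeM.
  - move=> x _; rewrite -EFinM lee_fin -expRD ler_expR.
    have : 0 <= k * (x ^+ 2 - 1) ^+ 2 by rewrite mulr_ge0 ?sqr_ge0 ?ltW.
    lra.
rewrite ge0_integralZl//.
by rewrite integral_gauss_scaled ?mulr_gt0// -EFinM ltry.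
Qed.

Lemma integral_quartic :
  (\int[leb]_s (expR (- (k * s ^+ 4)))%:E = (Gamma 4^-1 / (2 * k `^ 4^-1))%:E)%E.
Proof.
have kp : 0 < k `^ 4^-1 by exact: powR_gt0.
have cE : c = (k `^ 4^-1)^-1 by rewrite /c powRN.
pose J := (\int[leb]_(x in `]0%R, +oo[) (x `^ (4^-1 - 1) * expR (- x))%:E)%E.
have mG : measurable_fun setT (fun x : R => (x `^ (4^-1 - 1) * expR (- x))%:E).
  apply/measurable_EFinP; apply: measurable_funM; first exact: measurable_powR.
  by apply: measurableT_comp => //; exact: measurable_funN.
have J0 : (0 <= J)%E.
  by apply: integral_ge0 => x _; rewrite lee_fin mulr_ge0 ?powR_ge0 ?expR_ge0.
have cc : 0 < 2 * (4^-1 * c) by rewrite !mulr_gt0// invr_gt0.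
have E1 : (\int[leb]_s (G s)%:E = (2 * (4^-1 * c))%:E * J)%E.
  rewrite ge0_symfun_integralT; last 3 first.
  - by move=> x; exact: expR_ge0.
  - exact: continuous_exp_quartic.
  - by move=> x; rewrite /G /=; congr (expR (- (_ * _))); ring.
  rewrite (_ : [set x : R | 0 <= x] = `[0, +oo[%classic); last first.
    by apply/seteqP; split => x/=; rewrite in_itv/= andbT.
  rewrite -integral_itv_obnd_cbnd; last first.
    apply: measurable_funTS; apply/measurable_EFinP; apply: continuous_measurable_fun.
    exact: continuous_exp_quartic.
  rewrite half_line_eq EFinM -muleA; congr (_ * _)%E.
  under eq_integral do rewrite EFinM.
  rewrite ge0_integralZl//.
  - exact: measurable_funTS.
  - by move=> x _; rewrite lee_fin mulr_ge0 ?powR_ge0 ?expR_ge0.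
  - by rewrite lee_fin mulr_ge0// ltW.
have Jf : J \is a fin_num.
  rewrite ge0_fin_numE//; have := integral_quartic_lty.
  rewrite -/G E1 => lt; rewrite ltNge leye_eq; apply/eqP => JE.
  move: lt; rewrite JE.
  by rewrite gt0_muley ?lte_fin// ltxx.
rewrite E1 -(fineK Jf) -EFinM; congr EFin.
rewrite (_ : fine J = Gamma 4^-1)// cE; field; rewrite gt_eqF//.
Qed.

End quartic.

(** * The tilting kernel and its pointwise estimates *)

Section kernel.
Context {R : realType}.

(** The natural scale of the sum S_n / sqrt T_n. *)
Definition root4 (n : nat) : R := n%:R `^ 4^-1.

Lemma root4_ge0 n : 0 <= root4 n. Proof. exact: powR_ge0. Qed.

Lemma root4_gt0 n : (0 < n)%N -> 0 < root4 n.
Proof. by move=> n0; apply: powR_gt0; rewrite ltr0n. Qed.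

Lemma root4_pow4 n : root4 n ^+ 4 = n%:R.
Proof. by rewrite -powR_mulrn ?powR_ge0// -powRrM mulVf ?powRr1. Qed.

Lemma root4_ge1 n : (0 < n)%N -> 1 <= root4 n.
Proof.
move=> n0; have := root4_pow4 n; have := root4_ge0 n.
have : 1 <= n%:R :> R by rewrite ler1n.
move=> n1 b0 b4; rewrite -(@ler_pXn2r _ 4)// ?nnegrE//.
by rewrite expr1n b4.
Qed.

Lemma cvg_root4V : (root4 n)^-1 @[n --> \oo] --> 0.
Proof.
have h : root4 n @[n --> \oo] --> +oo.
  apply: (@cvg_comp _ _ _ (fun n : nat => n%:R : R) (fun x : R => x `^ 4^-1)).
    exact: cvgr_idn.
  by apply: cvg_powR_pinfty; rewrite invr_gt0.
apply: (iffRL (@gtr0_cvgV0 _ _ _ _ root4 _) h).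
by near=> n; apply: root4_gt0; near: n; exists 1%N.
Unshelve. all: by end_near. Qed.

(** The exponential tilt at level s when sumT x = t: tilt * sumS x is
    sqrt n * s * self_normalized n x. *)
Definition tilt n (s t : R) : R := root4 n * s / Num.sqrt t.

(** Up to constants, the density of the pair made of the vector x and of the
    smoothed variable s: the latter is self_normalized n x plus an independent
    centred Gaussian of variance n^(-1/2); see exp_kernelE. *)
Definition exp_kernel n (s : R) (x : n.-tuple R) : R :=
  expR (- (root4 n ^+ 2 * s ^+ 2 / 2)) * (0 < sumT x)%R%:R *
  expR (tilt n s (sumT x) * sumS x).

(** What exp_kernel becomes after averaging over the signs of the coordinates. *)
Definition cosh_kernel n (s : R) (x : n.-tuple R) : R :=
  expR (- (root4 n ^+ 2 * s ^+ 2 / 2)) * (0 < sumT x)%R%:R *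
  \prod_(i < n) cosh (tilt n s (sumT x) * tnth x i).

Lemma sumT_gt0_size n (x : n.-tuple R) : 0 < sumT x -> (0 < n)%N.
Proof. by case: n x => // x; rewrite /sumT big_ord0 ltxx. Qed.

(** Self-normalization at work: the sum of the squared arguments is
    deterministic, so the Gaussian prefactor of the kernel can be distributed
    over the factors cosh. *)
Lemma tilt_sqr n s (x : n.-tuple R) : 0 < sumT x ->
  \sum_(i < n) (tilt n s (sumT x) * tnth x i) ^+ 2 = root4 n ^+ 2 * s ^+ 2.
Proof.
move=> T0; under eq_bigr do rewrite exprMn.
rewrite -mulr_sumr -/(sumT x) /tilt !exprMn exprVn sqr_sqrtr ?ltW//.
by field; rewrite gt_eqF.
Qed.

Lemma cosh_kernel_prod n s (x : n.-tuple R) : 0 < sumT x ->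
  let y i := tilt n s (sumT x) * tnth x i in
  cosh_kernel s x = \prod_(i < n) (cosh (y i) * expR (- (y i ^+ 2 / 2))).
Proof.
move=> T0 y; rewrite big_split/= -expR_sum sumrN -mulr_suml tilt_sqr//.
by rewrite /cosh_kernel T0 mulr1 mulrC.
Qed.

Lemma cosh_kernel_ge0 n s (x : n.-tuple R) : 0 <= cosh_kernel s x.
Proof. by rewrite !mulr_ge0 ?expR_ge0// prod_cosh_ge0. Qed.

Lemma exp_kernel_ge0 n s (x : n.-tuple R) : 0 <= exp_kernel s x.
Proof. by rewrite !mulr_ge0 ?expR_ge0. Qed.

Lemma cosh_kernel_lower n s (x : n.-tuple R) : 0 < sumT x ->
  expR (- \sum_(i < n) (tilt n s (sumT x) * tnth x i) ^+ 4 / 12) <= cosh_kernel s x.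
Proof.
move=> T0; rewrite cosh_kernel_prod// -sumrN expR_sum.
by apply: ler_prod => i _; rewrite expR_ge0/= cosh_gauss_ge.
Qed.

Lemma cosh_kernel_upper n s (x : n.-tuple R) : 0 < sumT x ->
  cosh_kernel s x <= expR (- \sum_(i < n)
    (tilt n s (sumT x) * tnth x i) ^+ 4 / (12 * (1 + (tilt n s (sumT x) * tnth x i) ^+ 2))).
Proof.
move=> T0; rewrite cosh_kernel_prod// -sumrN expR_sum.
apply: ler_prod => i _; rewrite cosh_gauss_le andbT.
by rewrite mulr_ge0 ?expR_ge0// ltW// cosh_gt0.
Qed.

(** Affine minorants, in the variable t = y^2, of the convex function
    t^2 / (1 + t), with equality where t = l (1 + t). *)
Lemma quartic_ratio_ge (l y : R) :
  ((2 * l - l ^+ 2) * y ^+ 2 - l ^+ 2) / 12 <= y ^+ 4 / (12 * (1 + y ^+ 2)).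
Proof.
have p : 0 < 1 + y ^+ 2 by rewrite ltr_pwDl// sqr_ge0.
rewrite ler_pdivlMr ?mulr_gt0// mulrC.
have -> : 12 * (1 + y ^+ 2) * (((2 * l - l ^+ 2) * y ^+ 2 - l ^+ 2) / 12) =
  y ^+ 4 - (y ^+ 2 - l * (1 + y ^+ 2)) ^+ 2 by field.
by rewrite gerBl sqr_ge0.
Qed.

(** The integrable bound, uniform in n and x.  Summing quartic_ratio_ge over the
    coordinates only involves the sum of squares, which by tilt_sqr is the same
    for all x. *)
Lemma cosh_kernel_le n s (x : n.-tuple R) :
  cosh_kernel s x <= expR (- ((s ^+ 2 - 1) / 12)).
Proof.
have [T0|T0] := ltP 0 (sumT x); last first.
  by rewrite /cosh_kernel ltNge T0 mulr0 mul0r expR_ge0.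
have n0 := sumT_gt0_size T0.
apply: (le_trans (cosh_kernel_upper s T0)); rewrite ler_expR lerN2.
pose b := root4 n; have b1 : 1 <= b := root4_ge1 n0.
have b0 : 0 < b by rewrite root4_gt0.
(* When the arguments are all equal, their squares are s^2 n^(-1/2): this is the
   order at which the minorant has to be sharp. *)
pose l := (b ^+ 2)^-1.
apply: (@le_trans _ _ (\sum_(i < n) ((2 * l - l ^+ 2) *
    (tilt n s (sumT x) * tnth x i) ^+ 2 - l ^+ 2) / 12)); last first.
  by apply: ler_sum => i _; exact: quartic_ratio_ge.
rewrite -mulr_suml sumrB -mulr_sumr tilt_sqr// sumr_const card_ord -/b.
have -> : l ^+ 2 *+ n = l ^+ 2 * b ^+ 4 by rewrite root4_pow4 mulr_natr.
rewrite ler_pM2r ?invr_gt0//.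
have -> : (2 * l - l ^+ 2) * (b ^+ 2 * s ^+ 2) - l ^+ 2 * b ^+ 4 =
   2 * s ^+ 2 - l * s ^+ 2 - 1 by rewrite /l; field; rewrite gt_eqF.
have : l * s ^+ 2 <= s ^+ 2.
  rewrite ler_piMl ?sqr_ge0// /l invf_le1 ?exprn_gt0//.
  by rewrite exprn_ege1.
lra.
Qed.

Lemma cosh_kernel_le1 n s (x : n.-tuple R) : cosh_kernel s x <= 1.
Proof.
have [T0|T0] := ltP 0 (sumT x); last first.
  by rewrite /cosh_kernel ltNge T0 mulr0 mul0r.
apply: (le_trans (cosh_kernel_upper s T0)).
rewrite -expR0 ler_expR oppr_le0 sumr_ge0// => i _.
apply: divr_ge0; first exact: exprn_even_ge0.
by rewrite mulr_ge0// addr_ge0// sqr_ge0.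
Qed.

Lemma expRN_lip (u v : R) : 0 <= u -> 0 <= v ->
  `|expR (- u) - expR (- v)| <= `|u - v|.
Proof.
wlog uv : u v / u <= v.
  move=> H u0 v0; have [uv|/ltW vu] := leP u v; first exact: H.
  by rewrite distrC (distrC u); exact: H.
move=> u0 v0; rewrite ger0_norm ?subr_ge0 ?ler_expR ?lerN2//.
rewrite distrC ger0_norm ?subr_ge0//.
have : expR (- u) <= 1 by rewrite -expR0 ler_expR oppr_le0.
have -> : expR (- v) = expR (- u) * expR (u - v) by rewrite -expRD; congr expR; lra.
have := expR_ge1Dx (u - v); have := expR_gt0 (- u).
nra.
Qed.

Lemma quintic_remainder (y : R) :
  y ^+ 4 / 12 - y ^+ 4 / (12 * (1 + y ^+ 2)) <= `|y| ^+ 5 / 24.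
Proof.
have p : 0 < 1 + y ^+ 2 by rewrite ltr_pwDl// sqr_ge0.
have y2 : y ^+ 2 = `|y| ^+ 2 by rewrite real_normK ?num_real.
have y4 : y ^+ 4 = `|y| ^+ 4 by rewrite -[4%N]/(2 * 2)%N !exprM y2.
rewrite y4 y2 in p *; set z := `|y| in p *.
have z0 : 0 <= z by exact: normr_ge0.
have -> : z ^+ 4 / 12 - z ^+ 4 / (12 * (1 + z ^+ 2)) = z ^+ 6 / (12 * (1 + z ^+ 2)).
  by field; rewrite gt_eqF.
rewrite ler_pdivrMr ?mulr_gt0// -subr_ge0.
have -> : z ^+ 5 / 24 * (12 * (1 + z ^+ 2)) - z ^+ 6 = z ^+ 5 * (1 - z) ^+ 2 / 2 by field.
by rewrite divr_ge0// mulr_ge0 ?sqr_ge0// exprn_ge0.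
Qed.

Definition empirical_moment n (k : nat) (x : n.-tuple R) : R :=
  (\sum_(i < n) `|tnth x i| ^+ k) / n%:R.

Lemma empirical_moment_ge0 n k (x : n.-tuple R) : 0 <= empirical_moment k x.
Proof. by apply: divr_ge0 => //; apply: sumr_ge0 => i _; exact: exprn_ge0. Qed.

(** The exponent of the kernel is minus the sum of y_i^4 / 12 with
    y_i = n^(1/4) s x_i / sqrt (sumT x), up to the fifth powers; both sums are
    ratios of empirical moments by homogeneity. *)
Lemma cosh_kernel_quartic n s (x : n.-tuple R) : 0 < sumT x ->
  `|cosh_kernel s x - expR (- (s ^+ 4 / 12 *
      (empirical_moment 4 x / empirical_moment 2 x ^+ 2)))| <=
  `|s| ^+ 5 / 24 *
    (empirical_moment 5 x / (root4 n * Num.sqrt (empirical_moment 2 x) ^+ 5)).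
Proof.
move=> T0; have n0 := sumT_gt0_size T0.
have nR : 0 < n%:R :> R by rewrite ltr0n.
pose y i := tilt n s (sumT x) * tnth x i.
set b := root4 n; have b0 : 0 < b by rewrite root4_gt0.
have TE : sumT x = b ^+ 4 * empirical_moment 2 x.
  rewrite root4_pow4 /empirical_moment mulrC divfK ?gt_eqF//.
  by apply: eq_bigr => i _; rewrite real_normK ?num_real.
have A0 : 0 < empirical_moment 2 x.
  by move: T0; rewrite TE pmulr_rgt0// exprn_gt0.
have sT : Num.sqrt (sumT x) = b ^+ 2 * Num.sqrt (empirical_moment 2 x).
  have b4 : b ^+ 4 = (b ^+ 2) ^+ 2 by rewrite -exprM.
  rewrite TE b4 sqrtrM ?sqr_ge0//.
  by rewrite sqrtr_sqr ger0_norm// exprn_ge0// ltW.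
set q := Num.sqrt (empirical_moment 2 x); have q0 : 0 < q by rewrite sqrtr_gt0.
have q2 : q ^+ 2 = empirical_moment 2 x by rewrite sqr_sqrtr// ltW.
have tE : tilt n s (sumT x) = s / (b * q).
  by rewrite /tilt sT -/b -/q; field; rewrite !gt_eqF.
have bn : b ^+ 4 = n%:R by exact: root4_pow4.
have y4 : \sum_(i < n) y i ^+ 4 / 12 =
    s ^+ 4 / 12 * (empirical_moment 4 x / empirical_moment 2 x ^+ 2).
  rewrite -mulr_suml.
  under eq_bigr do rewrite /y exprMn.
  rewrite -mulr_sumr tE -q2 (_ : empirical_moment 4 x = (\sum_(i < n) tnth x i ^+ 4) / b ^+ 4).
    by field; rewrite !gt_eqF.
  rewrite /empirical_moment bn; congr (_ / _); apply: eq_bigr => i _.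
  by rewrite -[4%N]/(2 * 2)%N !exprM real_normK ?num_real.
have y5 : \sum_(i < n) `|y i| ^+ 5 / 24 =
    `|s| ^+ 5 / 24 * (empirical_moment 5 x / (b * q ^+ 5)).
  rewrite -mulr_suml.
  under eq_bigr do rewrite /y normrM exprMn.
  rewrite -mulr_sumr tE normrM (@ger0_norm _ (_^-1)) ?invr_ge0 ?mulr_ge0 ?ltW//.
  by rewrite /empirical_moment -bn; field; rewrite !gt_eqF.
rewrite -y4 -y5.
set U := \sum_(i < n) _ / 12.
pose W := \sum_(i < n) y i ^+ 4 / (12 * (1 + y i ^+ 2)).
have p4 i : 0 <= y i ^+ 4 by exact: exprn_even_ge0.
have W0 : 0 <= W.
  apply: sumr_ge0 => i _; apply: divr_ge0; first exact: p4.
  by rewrite mulr_ge0// addr_ge0// sqr_ge0.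
have U0 : 0 <= U by apply: sumr_ge0 => i _; apply: divr_ge0; first exact: p4.
have low : expR (- U) <= cosh_kernel s x := cosh_kernel_lower s T0.
have upp : cosh_kernel s x <= expR (- W) := cosh_kernel_upper s T0.
rewrite ger0_norm ?subr_ge0//.
apply: (@le_trans _ _ `|expR (- W) - expR (- U)|).
  by rewrite (le_trans _ (ler_norm _))// lerB.
apply: (le_trans (expRN_lip W0 U0)); rewrite distrC.
have WU : W <= U.
  apply: ler_sum => i _; rewrite ler_wpM2l// lef_pV2 ?posrE ?mulr_gt0//.
    by rewrite ler_pMr// lerDl sqr_ge0.
  by rewrite ltr_pwDl// sqr_ge0.
rewrite ger0_norm ?subr_ge0// /U /W -sumrB.
by apply: ler_sum => i _; exact: quintic_remainder.
Qed.

(** A single estimate, linear in the deviations of the empirical moments and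
    valid for every x, so that integrating it reduces the limit of the kernel to
    laws of large numbers in L^1.  When the empirical second moment is less than
    half of sigma2, its own deviation dominates since the kernel is in [0, 1]. *)
Lemma cosh_kernel_dist (s sigma2 mu4 : R) : 0 < sigma2 -> 0 <= mu4 ->
  exists2 K : R, 0 <= K & forall n (x : n.-tuple R), (0 < n)%N ->
  `|cosh_kernel s x - expR (- (mu4 / (12 * sigma2 ^+ 2) * s ^+ 4))| <=
  K * (`|empirical_moment 2 x - sigma2| + `|empirical_moment 4 x - mu4| +
       empirical_moment 5 x / root4 n).
Proof.
move=> s0 m0.
have s4 : 0 <= s ^+ 4 by exact: exprn_even_ge0.
pose K1 := `|s| ^+ 5 / 24 / Num.sqrt (sigma2 / 2) ^+ 5.
pose K2 := s ^+ 4 / 12 * (4 / sigma2 ^+ 2).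
pose K3 := s ^+ 4 / 12 * (mu4 * (6 / sigma2 ^+ 3)).
have K10 : 0 <= K1 by rewrite !divr_ge0 ?exprn_ge0 ?sqrtr_ge0.
have s12 : 0 <= s ^+ 4 / 12 by exact: divr_ge0.
have K20 : 0 <= K2 by apply: mulr_ge0 => //; rewrite divr_ge0// exprn_ge0// ltW.
have K30 : 0 <= K3.
  apply: mulr_ge0 => //; apply: mulr_ge0 => //.
  by rewrite divr_ge0// exprn_ge0// ltW.
have K40 : 0 <= 2 / sigma2 by rewrite divr_ge0 ?ltW.
exists (K1 + K2 + K3 + 2 / sigma2); first lra.
move=> n x n0; set A := empirical_moment 2 x; set B := empirical_moment 4 x.
set C := empirical_moment 5 x / _.
have C0 : 0 <= C by rewrite divr_ge0 ?root4_ge0// empirical_moment_ge0.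
have B0 : 0 <= B by exact: empirical_moment_ge0.
have NA := normr_ge0 (A - sigma2); have NB := normr_ge0 (B - mu4).
have e1 : expR (- (mu4 / (12 * sigma2 ^+ 2) * s ^+ 4)) <= 1.
  rewrite -expR0 ler_expR oppr_le0 mulr_ge0// divr_ge0// mulr_ge0// exprn_ge0// ltW//.
have e0 := expR_ge0 (- (mu4 / (12 * sigma2 ^+ 2) * s ^+ 4)).
have f1 := cosh_kernel_le1 s x; have f0 := cosh_kernel_ge0 s x.
have [sA|As] := leP (sigma2 / 2) A; last first.
  apply: (@le_trans _ _ 1).
    rewrite ler_norml; lra.
  have : 1 <= 2 / sigma2 * `|A - sigma2|.
    rewrite distrC -(ler_pM2l s0) mulr1 mulrA (mulrC sigma2) divfK ?gt_eqF//.
    have := ler_norm (sigma2 - A); lra.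
  nra.
have A0 : 0 < A by rewrite (lt_le_trans _ sA)// divr_gt0.
have T0 : 0 < sumT x.
  have nR : 0 < n%:R :> R by rewrite ltr0n.
  suff -> : sumT x = A * n%:R by rewrite mulr_gt0.
  rewrite /A /empirical_moment divfK ?gt_eqF//.
  by apply: eq_bigr => i _; rewrite real_normK ?num_real.
have := cosh_kernel_quartic s T0.
rewrite -/A -/B.
set u := s ^+ 4 / 12 * _; move=> Hq.
have u0 : 0 <= u.
  by apply: mulr_ge0 => //; apply: divr_ge0 => //; exact: exprn_even_ge0.
have v0 : 0 <= mu4 / (12 * sigma2 ^+ 2) * s ^+ 4.
  by rewrite mulr_ge0// divr_ge0// mulr_ge0// exprn_ge0// ltW.
have HL := expRN_lip u0 v0.
have H1 : `|s| ^+ 5 / 24 * (empirical_moment 5 x / (root4 n * Num.sqrt A ^+ 5)) <= K1 * C.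
  have b0 := @root4_gt0 n n0.
  have qA : 0 < Num.sqrt A by rewrite sqrtr_gt0.
  have qs : 0 < Num.sqrt (sigma2 / 2) by rewrite sqrtr_gt0 divr_gt0.
  rewrite (_ : _ * (_ / _) = `|s| ^+ 5 / 24 / Num.sqrt A ^+ 5 * C); last first.
    by rewrite /C; field; rewrite !gt_eqF.
  rewrite ler_wpM2r// /K1 ler_wpM2l ?divr_ge0 ?exprn_ge0//.
  rewrite lef_pV2 ?posrE ?exprn_gt0//.
  by rewrite ler_pXn2r ?nnegrE ?sqrtr_ge0// ler_wsqrtr.
have H2 : `|u - mu4 / (12 * sigma2 ^+ 2) * s ^+ 4| <=
    K2 * `|B - mu4| + K3 * `|A - sigma2|.
  rewrite (_ : u - _ = s ^+ 4 / 12 * ((B - mu4) / A ^+ 2) -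
     s ^+ 4 / 12 * (mu4 * ((A + sigma2) / (A ^+ 2 * sigma2 ^+ 2)) * (A - sigma2))); last first.
    by rewrite /u; field; rewrite !gt_eqF.
  rewrite (le_trans (ler_normB _ _))// lerD//.
    rewrite normrM (@ger0_norm _ (s ^+ 4 / 12)) // /K2.
    rewrite -[leRHS]mulrA; apply: ler_wpM2l => //.
    rewrite normrM mulrC ler_wpM2r// ger0_norm ?invr_ge0 ?exprn_ge0 ?(ltW A0)//.
    rewrite (_ : 4 / sigma2 ^+ 2 = ((sigma2 / 2) ^+ 2)^-1); last first.
      by field; rewrite gt_eqF.
    have s20 : 0 < sigma2 / 2 by rewrite divr_gt0.
    rewrite lef_pV2 ?posrE; [|exact: exprn_gt0|exact: exprn_gt0].
    by apply: lerXn2r; rewrite ?nnegrE ?(ltW A0) ?(ltW s20).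
  rewrite normrM (@ger0_norm _ (s ^+ 4 / 12)) // /K3.
  rewrite -[leRHS]mulrA; apply: ler_wpM2l => //.
  rewrite normrM ler_wpM2r// normrM (ger0_norm m0) ler_wpM2l//.
  rewrite ger0_norm; last first.
    apply: divr_ge0; first by rewrite addr_ge0// ltW.
    by rewrite mulr_ge0// exprn_ge0// ltW.
  have p0 : 0 < A ^+ 2 * sigma2 ^+ 2.
    by apply: mulr_gt0; exact: exprn_gt0.
  rewrite (ler_pdivrMr _ _ p0) -subr_ge0.
  rewrite (_ : _ - _ = (6 * A ^+ 2 - (A + sigma2) * sigma2) / sigma2); last first.
    by field; rewrite gt_eqF.
  rewrite divr_ge0 ?(ltW s0)//; nra.
have H3 : `|cosh_kernel s x - expR (- (mu4 / (12 * sigma2 ^+ 2) * s ^+ 4))| <=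
   K1 * C + (K2 * `|B - mu4| + K3 * `|A - sigma2|).
  rewrite -(subrKA (expR (- u))) (le_trans (ler_normD _ _))// lerD//.
    exact: le_trans Hq H1.
  exact: le_trans HL H2.
apply: (le_trans H3).
nra.
Qed.

End kernel.

(** * Comparison of a test function at two nearby points *)

Section slutsky_bound.
Context {R : realType}.

Lemma continuous_unif_segment (f : R -> R) (K e : R) : continuous f -> 0 < e ->
  exists2 dl : R, 0 < dl & forall s u, `|s| <= K -> `|u - s| < dl -> `|f u - f s| <= e.
Proof.
move=> cf e0.
have /compact_near_coveringP h := @segment_compact R (- K) K.
have := h R (0^'+) (fun dl s => forall u, `|u - s| < dl -> `|f u - f s| <= e).
move=> /(_ _ _) H.
have {}H : \forall dl \near 0^'+, `[- K, K] `<=`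
    (fun s => forall u, `|u - s| < dl -> `|f u - f s| <= e).
  apply: H => s0 _.
  have e2 : 0 < e / 2 by rewrite divr_gt0.
  have /cvgrPdist_lt /(_ _ e2) := cf s0.
  move=> /nbhs_ballP[d0 /= d00 Hd].
  exists (ball s0 (d0 / 2), [set dl | dl < d0 / 2]) => /=.
    split; first by apply: nbhsx_ballx; rewrite divr_gt0.
    by apply: nbhs_right_lt; rewrite divr_gt0.
  move=> [s dl] /= [] ss0 dld u us.
  have h1 : `|f s0 - f u| < e / 2.
    apply: Hd; rewrite /ball/= in ss0 *.
    rewrite (_ : s0 - u = (s0 - s) - (u - s)); last by ring.
    rewrite (le_lt_trans (ler_normB _ _))//; lra.
  have h2 : `|f s0 - f s| < e / 2.
    apply: Hd; rewrite /ball/= in ss0 *; lra.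
  rewrite (_ : f u - f s = (f s0 - f s) - (f s0 - f u)); last by ring.
  rewrite (le_trans (ler_normB _ _))//; lra.
have [dl [dl0 Hdl]] : exists dl, 0 < dl /\ (`[- K, K] `<=`
    (fun s => forall u, `|u - s| < dl -> `|f u - f s| <= e)).
  near (0 : R)^'+ => dl; exists dl; split; first by [].
  by near: dl; exact: H.
exists dl => // s u sK us; apply: Hdl => //=.
by rewrite in_itv/= -ler_norml.
Unshelve. all: by end_near. Qed.

(** Uniform continuity holds on compact sets only; when s or s - u is large the
    quadratic terms exceed M, which bounds the left-hand side.  Only second
    moments of s and of s - u then remain to be controlled. *)
Lemma quadratic_modulus (f : R -> R) (M e : R) : continuous f ->
  (forall u, 0 <= f u <= M) -> 0 < e ->
  exists2 C : R, 0 <= C & forall u s,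
    `|f u - f s| <= e + e * s ^+ 2 + C * (s - u) ^+ 2.
Proof.
move=> cf fM e0.
have M0 : 0 <= M by have := fM 0; lra.
have fd u s : `|f u - f s| <= M.
  by have := fM u; have := fM s; rewrite ler_norml; lra.
pose K := M / e + 1.
have K1 : 1 <= K by rewrite lerDr divr_ge0// ltW.
have eK : M <= e * K ^+ 2.
  have : M <= e * K by rewrite mulrDr mulrC divfK ?gt_eqF// mulr1; lra.
  have : e * K <= e * K ^+ 2 by rewrite ler_pM2l// expr2 ler_peMl//; lra.
  lra.
have [dl dl0 Hd] := continuous_unif_segment K cf e0.
exists (M / dl ^+ 2); first by rewrite divr_ge0// sqr_ge0.
move=> u s.
have p1 : 0 <= e * s ^+ 2 by rewrite mulr_ge0 ?sqr_ge0// ltW.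
have p2 : 0 <= M / dl ^+ 2 * (s - u) ^+ 2.
  by apply: mulr_ge0; [rewrite divr_ge0// sqr_ge0|exact: sqr_ge0].
have [sK|Ks] := leP `|s| K; last first.
  have : e * K ^+ 2 <= e * s ^+ 2.
    rewrite ler_pM2l// -(@real_normK _ s) ?num_real//.
    by apply: lerXn2r; rewrite ?nnegrE ?(ltW Ks)//; lra.
  have := fd u s; lra.
have [us|us] := ltP `|u - s| dl.
  have := Hd s u sK us; lra.
have : M <= M / dl ^+ 2 * (s - u) ^+ 2.
  rewrite -mulrA ler_peMr// mulrC ler_pdivlMr ?exprn_gt0// mul1r.
  rewrite -(@real_normK _ (s - u)) ?num_real// distrC.
  by apply: lerXn2r; rewrite ?nnegrE ?(ltW dl0).
have := fd u s; lra.
Qed.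

End slutsky_bound.

(** * Gaussian smoothing of the Curie-Weiss weight *)

Section gaussian_kernel.
Context {R : realType}.

(** Completing the square: this identity is the Hubbard-Stratonovich
    linearization exp (U^2/2) = E [exp (U G)] with G a standard Gaussian. *)
Lemma exp_kernelE n (s : R) (x : n.-tuple R) : exp_kernel s x =
  cw_weight x * expR (- (root4 n ^+ 2 / 2 * (s - self_normalized n x) ^+ 2)).
Proof.
rewrite /exp_kernel /cw_weight indicE.
have -> : (x \in [set y | 0 < sumT y]) = (0 < sumT x) by apply/asboolP/idP.
have [T0|T0] := ltP 0 (sumT x); last by rewrite !mulr0 !mul0r.
have b0 := @root4_gt0 R _ (sumT_gt0_size T0).
rewrite !mulr1 -!expRD; congr expR.
have q0 : 0 < Num.sqrt (sumT x) by rewrite sqrtr_gt0.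
have := sqr_sqrtr (ltW T0); rewrite /tilt /self_normalized -/(root4 n).
move: q0; set q := Num.sqrt _; move=> q0 <-.
by field; rewrite !gt_eqF.
Qed.

End gaussian_kernel.

Section joint_integral.
Local Open Scope ereal_scope.
Context {R : realType}.
Notation leb := (@lebesgue_measure R).
Variable rho : probability R R.

Lemma measurable_cw_weight n : measurable_fun setT (@cw_weight R n).
Proof.
have mT : measurable_fun setT (@sumT R n) := @measurable_sumT R n.
have mS : measurable_fun setT (@sumS R n) := @measurable_sumS R n.
rewrite (_ : @cw_weight R n = fun x =>
   (expR (2^-1 * (sumS x ^+ 2 * sumT x `^ (- 1))) * \1_[set y | 0 < @sumT R n y] x)%R); last first.
  apply/funext => x; rewrite /cw_weight powR_inv1//.
  by apply: sumr_ge0 => i _; exact: sqr_ge0.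
apply: measurable_funM.
  apply: measurableT_comp => //; apply: measurable_funM => //.
  apply: measurable_funM; first exact: measurable_funX.
  exact: (measurableT_comp (measurable_powR _)).
apply: measurable_indic.
rewrite (_ : [set y | _] = @sumT R n @^-1` `]0%R, +oo[); last first.
  by apply/seteqP; split => y /=; rewrite in_itv/= andbT.
by rewrite -[X in measurable X]setTI; exact: mT.
Qed.

Lemma cw_weight_ge0 n (x : n.-tuple R) : (0 <= cw_weight x)%R.
Proof. by rewrite mulr_ge0 ?expR_ge0. Qed.

Lemma measurable_self_normalized n :
  measurable_fun setT (fun x : n.-tuple R => self_normalized n x).
Proof. exact: measurable_funPT. Qed.

Lemma measurable_exp_kernel n : measurable_fun setT
  (fun p : n.-tuple R * R => exp_kernel p.2 p.1).
Proof.
under eq_fun do rewrite exp_kernelE.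
apply: measurable_funM; first exact: (measurableT_comp (@measurable_cw_weight n)).
apply: measurableT_comp => //; apply: measurable_funN.
apply: measurable_funM => //; apply: measurable_funX.
apply: measurable_funB => //; exact: (measurableT_comp (@measurable_self_normalized n)).
Qed.

(** The integral over s of the Gaussian factor of exp_kernel. *)
Definition gauss_mass n : R := Num.sqrt (pi / (root4 n ^+ 2 / 2)).

Lemma gauss_mass_gt0 n : (0 < n)%N -> (0 < gauss_mass n)%R.
Proof.
move=> n0; rewrite sqrtr_gt0 divr_gt0 ?pi_gt0// divr_gt0// exprn_gt0//.
exact: root4_gt0.
Qed.

Lemma integral_exp_kernel n (x : n.-tuple R) : (0 < n)%N ->
  \int[leb]_s (exp_kernel s x)%:E = (gauss_mass n * cw_weight x)%:E.
Proof.
move=> n0; under eq_integral do rewrite exp_kernelE EFinM.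
rewrite ge0_integralZl//.
- rewrite integral_gauss_scaled ?divr_gt0 ?exprn_gt0 ?root4_gt0//.
  by rewrite -EFinM mulrC.
- exact: measurable_exp_gauss.
- by rewrite lee_fin cw_weight_ge0.
Qed.

(** Half of the Gaussian exponent is spent to absorb the square, by z <= exp z. *)
Lemma integral_sqr_exp_kernel n (x : n.-tuple R) : (0 < n)%N ->
  \int[leb]_s ((s - self_normalized n x) ^+ 2 * exp_kernel s x)%:E <=
  (8 / root4 n ^+ 2 * (gauss_mass n * cw_weight x))%:E.
Proof.
move=> n0; set V := self_normalized n x; set b := root4 n.
have b0 : (0 < b)%R by exact: root4_gt0.
have b20 : (0 < b ^+ 2)%R by exact: exprn_gt0.
apply: (@le_trans _ _ (\int[leb]_s ((cw_weight x * (4 / b ^+ 2))%:E *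
    (expR (- (b ^+ 2 / 4 * (s - V) ^+ 2)))%:E))).
  apply: ge0_le_integral => //.
  - by move=> s _; rewrite lee_fin mulr_ge0 ?sqr_ge0 ?exp_kernel_ge0.
  - apply/measurable_EFinP; apply: measurable_funM.
      by apply: measurable_funX; exact: measurable_funB.
    exact: (measurableT_comp (@measurable_exp_kernel n) (pair1_measurable x)).
  - by apply: measurable_funeM; exact: measurable_exp_gauss.
  - move=> s _; rewrite -EFinM lee_fin exp_kernelE -/V -/b.
    set z := ((s - V) ^+ 2)%R.
    rewrite [leLHS]mulrCA -[leRHS]mulrA ler_wpM2l ?cw_weight_ge0//.
    rewrite (_ : - (b ^+ 2 / 2 * z) = - (b ^+ 2 / 4 * z) - (b ^+ 2 / 4 * z))%R; last by field.
    rewrite expRD mulrA ler_wpM2r ?expR_ge0//.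
    have h : (b ^+ 2 / 4 * z <= expR (b ^+ 2 / 4 * z))%R.
      by rewrite (le_trans _ (expR_ge1Dx _))// lerDr.
    rewrite expRN ler_pdivrMr ?expR_gt0//.
    rewrite [leLHS](_ : z = 4 / b ^+ 2 * (b ^+ 2 / 4 * z))%R; last by field; rewrite gt_eqF.
    by rewrite ler_wpM2l// divr_ge0// ltW.
rewrite ge0_integralZl//; last 2 first.
- exact: measurable_exp_gauss.
- by rewrite lee_fin mulr_ge0 ?cw_weight_ge0// divr_ge0// ltW.
rewrite integral_gauss_scaled ?divr_gt0// -EFinM lee_fin.
rewrite (_ : 8 / b ^+ 2 * (gauss_mass n * cw_weight x) =
  cw_weight x * (4 / b ^+ 2) * (2 * gauss_mass n))%R; last by field; rewrite gt_eqF.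
rewrite ler_wpM2l//; first by rewrite mulr_ge0 ?cw_weight_ge0// divr_ge0// ltW.
rewrite -(@ler_pXn2r _ 2)// ?nnegrE ?sqrtr_ge0 ?mulr_ge0 ?sqrtr_ge0//.
have p0 : (0 <= pi :> R)%R by exact: pi_ge0.
rewrite /gauss_mass -/b exprMn !sqr_sqrtr; last 2 first.
- by rewrite divr_ge0// divr_ge0// ltW.
- by rewrite divr_ge0// divr_ge0// ltW.
rewrite -subr_ge0 (_ : _ - _ = 4 * pi / b ^+ 2)%R; last by field; rewrite gt_eqF.
by rewrite divr_ge0 ?mulr_ge0// ltW.
Qed.

(** The smoothed variable is the second component and the vector the first; this
    integral lets a function of either be compared with a function of the
    other. *)
Definition joint_integral n (a : n.-tuple R * R -> R) : \bar R :=
  \int[power_prob rho n \x leb]_p (a p * exp_kernel p.2 p.1)%:E.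

Let mak n (a : n.-tuple R * R -> R) : measurable_fun setT a ->
  measurable_fun setT (fun p => (a p * exp_kernel p.2 p.1)%:E).
Proof.
move=> ma; apply/measurable_EFinP; apply: measurable_funM => //.
exact: measurable_exp_kernel.
Qed.

Let ak0 n (a : n.-tuple R * R -> R) : (forall p, 0 <= a p)%R ->
  forall p, 0 <= (a p * exp_kernel p.2 p.1)%:E.
Proof. by move=> a0 p; rewrite lee_fin mulr_ge0 ?exp_kernel_ge0. Qed.

Lemma joint_integral_ge0 n (a : n.-tuple R * R -> R) :
  (forall p, 0 <= a p)%R -> 0 <= joint_integral a.
Proof. by move=> a0; apply: integral_ge0 => p _; exact: ak0. Qed.

Lemma joint_integral_le n (a b : n.-tuple R * R -> R) :
  measurable_fun setT a -> measurable_fun setT b ->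
  (forall p, 0 <= a p)%R -> (forall p, a p <= b p)%R ->
  joint_integral a <= joint_integral b.
Proof.
move=> ma mb a0 ab; apply: ge0_le_integral => //.
- by move=> p _; exact: ak0.
- exact: mak.
- exact: mak.
- by move=> p _; rewrite lee_fin ler_wpM2r// exp_kernel_ge0.
Qed.

Lemma joint_integralD n (a b : n.-tuple R * R -> R) :
  measurable_fun setT a -> measurable_fun setT b ->
  (forall p, 0 <= a p)%R -> (forall p, 0 <= b p)%R ->
  joint_integral (fun p => a p + b p)%R = joint_integral a + joint_integral b.
Proof.
move=> ma mb a0 b0; rewrite -ge0_integralD//.
- by apply: eq_integral => p _; rewrite mulrDl EFinD.
- by move=> p _; exact: ak0.
- exact: mak.
- by move=> p _; exact: ak0.
- exact: mak.
Qed.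

Lemma joint_integralZ n c (a : n.-tuple R * R -> R) :
  measurable_fun setT a -> (forall p, 0 <= a p)%R -> (0 <= c)%R ->
  joint_integral (fun p => c * a p)%R = c%:E * joint_integral a.
Proof.
move=> ma a0 c0; rewrite -ge0_integralZl//.
- by apply: eq_integral => p _; rewrite -mulrA EFinM.
- exact: mak.
- by move=> p _; exact: ak0.
Qed.

(** The density at s of the smoothed law, before normalization. *)
Definition tilted_mass n s : \bar R := \int[power_prob rho n]_x (exp_kernel s x)%:E.

Lemma joint_integral_snd n (g : R -> R) :
  measurable_fun setT g -> (forall s, 0 <= g s)%R ->
  joint_integral (fun p : n.-tuple R * R => g p.2) =
  \int[leb]_s ((g s)%:E * tilted_mass n s).
Proof.
move=> mg g0; rewrite /joint_integral fubini_tonelli2//; last 2 first.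
- by apply: mak; exact: (measurableT_comp mg measurable_snd).
- by apply: ak0 => p.
apply: eq_integral => s _; rewrite /fubini_G/=.
under eq_integral do rewrite EFinM.
rewrite ge0_integralZl//.
- apply/measurable_EFinP.
  exact: (measurableT_comp (@measurable_exp_kernel n) (pair2_measurable s)).
- by move=> x _; rewrite lee_fin exp_kernel_ge0.
- by rewrite lee_fin.
Qed.

Lemma joint_integral_self_normalized n (f : R -> R) :
  measurable_fun setT f -> (forall s, 0 <= f s)%R ->
  (0 < n)%N ->
  joint_integral (fun p : n.-tuple R * R => f (self_normalized n p.1)) =
  (gauss_mass n)%:E *
  \int[power_prob rho n]_x (f (self_normalized n x) * cw_weight x)%:E.
Proof.
move=> mf f0 n0; rewrite /joint_integral fubini_tonelli1//; last 2 first.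
- apply: mak; apply: measurableT_comp => //.
  exact: (measurableT_comp (@measurable_self_normalized n)).
- by apply: ak0 => p.
rewrite -ge0_integralZl//.
- apply: eq_integral => x _; rewrite /fubini_F/=.
  under eq_integral do rewrite EFinM.
  rewrite ge0_integralZl//.
  + by rewrite integral_exp_kernel// -!EFinM mulrCA.
  + apply/measurable_EFinP.
    exact: (measurableT_comp (@measurable_exp_kernel n) (pair1_measurable x)).
  + by move=> s _; rewrite lee_fin exp_kernel_ge0.
  + by rewrite lee_fin.
- apply/measurable_EFinP; apply: measurable_funM; last exact: measurable_cw_weight.
  by apply: measurableT_comp => //; exact: measurable_self_normalized.
- by move=> x _; rewrite lee_fin mulr_ge0 ?cw_weight_ge0.
- by rewrite lee_fin ltW// gauss_mass_gt0.
Qed.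

Lemma joint_integral_sqr n : (0 < n)%N ->
  joint_integral (fun p : n.-tuple R * R => (p.2 - self_normalized n p.1) ^+ 2)%R <=
  (8 / root4 n ^+ 2)%:E * joint_integral (fun p : n.-tuple R * R => 1%R).
Proof.
move=> n0.
have := @joint_integral_self_normalized n (fun=> 1%R) (measurable_cst _) (fun=> ler01) n0 => ->.
have b0 : (0 <= 8 / root4 n ^+ 2 :> R)%R.
  by rewrite divr_ge0// exprn_ge0// root4_ge0.
rewrite /joint_integral fubini_tonelli1//; last 2 first.
- apply: mak; apply: measurable_funX; apply: measurable_funB => //.
  exact: (measurableT_comp (@measurable_self_normalized n)).
- by apply: ak0 => p; exact: sqr_ge0.
have mw1 : measurable_fun setT (fun x : n.-tuple R => (1 * cw_weight x)%:E).
  by apply/measurable_EFinP; apply: measurable_funM => //; exact: (@measurable_cw_weight n).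
have mgw : measurable_fun setT
    (fun x : n.-tuple R => (gauss_mass n)%:E * (1 * cw_weight x)%:E).
  exact: measurable_funeM.
rewrite -!ge0_integralZl//; last 3 first.
- by move=> x _; rewrite -EFinM lee_fin mul1r mulr_ge0 ?cw_weight_ge0// ltW// gauss_mass_gt0.
- by move=> x _; rewrite lee_fin mul1r cw_weight_ge0.
- by rewrite lee_fin ltW// gauss_mass_gt0.
apply: ge0_le_integral => //.
- by move=> x _; apply: integral_ge0 => s _; rewrite lee_fin mulr_ge0 ?sqr_ge0 ?exp_kernel_ge0.
- apply: measurable_fun_fubini_tonelli_F.
    apply: mak; apply: measurable_funX; apply: measurable_funB => //.
    exact: (measurableT_comp (@measurable_self_normalized n)).
  by apply: ak0 => p; exact: sqr_ge0.
- exact: measurable_funeM.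
- move=> x _; rewrite -!EFinM mul1r; exact: integral_sqr_exp_kernel.
Qed.

(** The Slutsky step: the error made in replacing self_normalized n x by s is
    governed by quadratic_modulus, whose last term contributes, relatively
    to the total mass, at the order n^(-1/2) by joint_integral_sqr. *)
Lemma joint_integral_compare n (a b : n.-tuple R * R -> R) (e C : R) : (0 < n)%N ->
  measurable_fun setT a -> measurable_fun setT b ->
  (forall p, 0 <= a p)%R -> (forall p, 0 <= b p)%R -> (0 <= e)%R -> (0 <= C)%R ->
  (forall p, a p <= b p +
    (e + e * p.2 ^+ 2 + C * (p.2 - self_normalized n p.1) ^+ 2))%R ->
  joint_integral a <= joint_integral b +
   (e%:E * joint_integral (fun p : n.-tuple R * R => 1%R) +
    e%:E * joint_integral (fun p : n.-tuple R * R => p.2 ^+ 2)%R +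
    (C * (8 / root4 n ^+ 2))%:E * joint_integral (fun p : n.-tuple R * R => 1%R)).
Proof.
move=> n0 ma mb a0 b0 e0 C0 ab.
pose f1 (p : n.-tuple R * R) : R := 1%R.
pose f2 (p : n.-tuple R * R) : R := (p.2 ^+ 2)%R.
pose f3 (p : n.-tuple R * R) : R := ((p.2 - self_normalized n p.1) ^+ 2)%R.
have mf1 : measurable_fun setT f1 by exact: measurable_cst.
have mf2 : measurable_fun setT f2 by apply: measurable_funX; exact: measurable_snd.
have mf3 : measurable_fun setT f3.
  apply: measurable_funX; apply: measurable_funB => //.
  exact: (measurableT_comp (@measurable_self_normalized n)).
have f10 p : (0 <= f1 p)%R by [].
have f20 p : (0 <= f2 p)%R by exact: sqr_ge0.
have f30 p : (0 <= f3 p)%R by exact: sqr_ge0.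
apply: (@le_trans _ _ (joint_integral (fun p => b p + ((e * f1 p + e * f2 p) + C * f3 p))%R)).
  apply: joint_integral_le => //.
    apply: measurable_funD => //; apply: measurable_funD; last exact: measurable_funM.
    by apply: measurable_funD; exact: measurable_funM.
  by move=> p; rewrite /f1 mulr1; exact: ab.
rewrite joint_integralD//; last 2 first.
- apply: measurable_funD; last exact: measurable_funM.
  by apply: measurable_funD; exact: measurable_funM.
- by move=> p; apply: addr_ge0; [apply: addr_ge0|]; apply: mulr_ge0.
rewrite leeD2l// joint_integralD//; last 4 first.
- by apply: measurable_funD; exact: measurable_funM.
- exact: measurable_funM.
- by move=> p; apply: addr_ge0; apply: mulr_ge0.
- by move=> p; apply: mulr_ge0.
rewrite joint_integralD//; last 4 first.
- exact: measurable_funM.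
- exact: measurable_funM.
- by move=> p; apply: mulr_ge0.
- by move=> p; apply: mulr_ge0.
rewrite !joint_integralZ// leeD2l// EFinM -muleA lee_wpmul2l ?lee_fin//.
exact: joint_integral_sqr.
Qed.

End joint_integral.

(** * Limit of the smoothed law *)

Section tilted_mass_limit.
Local Open Scope ereal_scope.
Context {R : realType}.
Notation leb := (@lebesgue_measure R).
Variable rho : probability R R.
Hypothesis rho_symmetric : forall A : set R, measurable A ->
       pushforward rho (-%R : R -> R) A = rho A.

Lemma measurable_tilt n s : measurable_fun setT (@tilt R n s).
Proof.
rewrite /tilt; apply: measurable_funM => //.
rewrite (_ : (fun t => _) = fun t : R => (Num.sqrt t) `^ (- 1))%R; last first.
  by apply/funext => t; rewrite powR_inv1// sqrtr_ge0.
apply: (measurableT_comp (measurable_powR _)).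
by apply: continuous_measurable_fun; exact: sqrt_continuous.
Qed.

Lemma measurable_pos_indic : measurable_fun setT (fun t : R => (0 < t)%R%:R : R).
Proof.
rewrite (_ : (fun t => _) = \1_(`]0%R, +oo[%classic : set R)); last first.
  apply/funext => t; rewrite indicE; congr (_%:R).
  by rewrite mem_setE in_itv/= andbT.
exact: measurable_indic.
Qed.

Lemma measurable_cosh_kernel n s : measurable_fun setT (@cosh_kernel R n s).
Proof.
apply: measurable_funM.
  apply: measurable_funM => //.
  exact: (measurableT_comp measurable_pos_indic (@measurable_sumT R n)).
apply: measurable_prod_cosh; exact: measurable_tilt.
Qed.

Lemma tilted_mass_cosh n s :
  tilted_mass rho n s = \int[power_prob rho n]_x (cosh_kernel s x)%:E.
Proof.
pose psi (t : R) := (expR (- (root4 n ^+ 2 * s ^+ 2 / 2)) * (0 < t)%R%:R)%R.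
apply: (@integral_symmetrize R rho rho_symmetric n psi (tilt n s)).
- by apply: measurable_funM => //; exact: measurable_pos_indic.
- exact: measurable_tilt.
- by move=> t; rewrite mulr_ge0 ?expR_ge0.
Qed.

Lemma tilted_mass_ge0 n s : 0 <= tilted_mass rho n s.
Proof. by apply: integral_ge0 => x _; rewrite lee_fin exp_kernel_ge0. Qed.

Lemma tilted_mass_le n s : tilted_mass rho n s <= (expR (- ((s ^+ 2 - 1) / 12)))%:E.
Proof.
rewrite tilted_mass_cosh -[leRHS]mule1 -(@probability_setT _ _ _ (power_prob rho n)).
rewrite -integral_cst//; apply: ge0_le_integral => //.
- by move=> x _; rewrite lee_fin cosh_kernel_ge0.
- by apply/measurable_EFinP; exact: measurable_cosh_kernel.
- by move=> x _; rewrite lee_fin cosh_kernel_le.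
Qed.

Lemma measurable_tilted_mass n : measurable_fun setT (tilted_mass rho n).
Proof.
apply: (@measurable_fun_fubini_tonelli_G _ _ _ _ R (power_prob rho n)
  (fun p => (exp_kernel p.2 p.1)%:E)).
  by apply/measurable_EFinP; exact: measurable_exp_kernel.
by move=> p; rewrite lee_fin exp_kernel_ge0.
Qed.

Variables (sigma2 mu4 m5 : R).
Hypothesis sigma2E : \int[rho]_z (`|z| ^+ 2)%:E = sigma2%:E.
Hypothesis mu4E : \int[rho]_z (`|z| ^+ 4)%:E = mu4%:E.
Hypothesis m5E : \int[rho]_z (`|z| ^+ 5)%:E = m5%:E.
Hypothesis sigma2_gt0 : (0 < sigma2)%R.

Let mpow k : measurable_fun setT (fun z : R => `|z| ^+ k)%R.
Proof. by apply: measurable_funX; exact: normr_measurable. Qed.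

Let pow0 k (z : R) : (0 <= `|z| ^+ k)%R. Proof. exact: exprn_ge0. Qed.

Let mu40 : (0 <= mu4)%R.
Proof. by rewrite -lee_fin -mu4E integral_ge0// => z _; rewrite lee_fin. Qed.

Let measurable_empirical_moment n k : measurable_fun setT (@empirical_moment R n k).
Proof.
apply: measurable_funM => //.
exact: (@measurable_sum_tnth _ R R (fun z => `|z| ^+ k)%R).
Qed.

Let weak_mean k (m e : R) : \int[rho]_z (`|z| ^+ k)%:E = m%:E -> (0 < e)%R ->
  \forall n \near \oo,
    \int[power_prob rho n]_x (`|empirical_moment k x - m|)%:E <= e%:E.
Proof.
move=> mE e0.
have := @weak_law _ R R rho (fun z => `|z| ^+ k)%R e (mpow k) (pow0 k).
by rewrite mE ltry; apply.
Qed.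

Let integral_empirical_moment5 n : (0 < n)%N ->
  \int[power_prob rho n]_x (empirical_moment 5 x)%:E = m5%:E.
Proof.
move=> n0; rewrite /empirical_moment.
under eq_integral do rewrite mulrC EFinM.
rewrite ge0_integralZl//.
- rewrite (@integral_sum_tnth _ R R rho (fun z => `|z| ^+ 5)%R)// m5E -!EFinM.
  by rewrite mulrA mulVf ?mul1r// pnatr_eq0 -lt0n.
- by apply/measurable_EFinP; exact: (@measurable_sum_tnth _ R R (fun z => `|z| ^+ 5)%R).
- by move=> x _; rewrite lee_fin sumr_ge0.
Qed.

(** Pointwise limit of the smoothed density: integrate cosh_kernel_dist and apply
    the weak law to the second and fourth powers; the fifth moment enters
    through a term of order n^(-1/4). *)
Lemma cvg_tilted_mass s : tilted_mass rho n s @[n --> \oo] -->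
  (expR (- (mu4 / (12 * sigma2 ^+ 2) * s ^+ 4)))%:E.
Proof.
set L := expR _.
have [K K0 HK] := cosh_kernel_dist s sigma2_gt0 mu40.
have fin n : tilted_mass rho n s \is a fin_num.
  by rewrite ge0_fin_numE ?tilted_mass_ge0// (le_lt_trans (tilted_mass_le n s)) ?ltry.
have bound n : (0 < n)%N -> `|tilted_mass rho n s - L%:E| <=
   K%:E * (\int[power_prob rho n]_x (`|empirical_moment 2 x - sigma2|)%:E +
   \int[power_prob rho n]_x (`|empirical_moment 4 x - mu4|)%:E + (m5 / root4 n)%:E).
  move=> n0.
  have mF : measurable_fun setT (fun x : n.-tuple R => (cosh_kernel s x)%:E).
    by apply/measurable_EFinP; exact: measurable_cosh_kernel.
  have iF : (power_prob rho n).-integrable setT (fun x => (cosh_kernel s x)%:E).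
    apply/integrableP; split => //.
    under eq_integral do rewrite gee0_abs ?lee_fin ?cosh_kernel_ge0//.
    by rewrite -tilted_mass_cosh -ge0_fin_numE ?tilted_mass_ge0.
  have iL : (power_prob rho n).-integrable setT (fun x => L%:E).
    exact: finite_measure_integrable_cst.
  have -> : tilted_mass rho n s - L%:E =
      \int[power_prob rho n]_x ((cosh_kernel s x)%:E - L%:E).
    rewrite integralB// -tilted_mass_cosh; congr (_ - _).
    by rewrite integral_cst//= probability_setT mule1.
  have m2 : measurable_fun setT (fun x : n.-tuple R => (`|empirical_moment 2 x - sigma2|)%:E).
    apply/measurable_EFinP; apply: measurableT_comp => //.
    by apply: measurable_funB => //; exact: measurable_empirical_moment.
  have m4 : measurable_fun setT (fun x : n.-tuple R => (`|empirical_moment 4 x - mu4|)%:E).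
    apply/measurable_EFinP; apply: measurableT_comp => //.
    by apply: measurable_funB => //; exact: measurable_empirical_moment.
  have m5' : measurable_fun setT (fun x : n.-tuple R => (empirical_moment 5 x)%:E).
    by apply/measurable_EFinP; exact: measurable_empirical_moment.
  have mm5 : measurable_fun setT
      (fun x : n.-tuple R => (root4 n)^-1%:E * (empirical_moment 5 x)%:E).
    exact: measurable_funeM.
  apply: le_trans (le_abse_integral _ _ _) _ => //.
    by apply: emeasurable_funB.
  apply: (@le_trans _ _ (\int[power_prob rho n]_x (K%:E *
    ((`|empirical_moment 2 x - sigma2|)%:E + (`|empirical_moment 4 x - mu4|)%:E +
      (root4 n)^-1%:E * (empirical_moment 5 x)%:E)))).
    apply: ge0_le_integral => //.
    - by apply: measurableT_comp => //; exact: emeasurable_funB.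
    - by apply: measurable_funeM; apply: emeasurable_funD => //; exact: emeasurable_funD.
    - move=> x _; rewrite -!EFinM -!EFinD lee_fin (le_trans (HK n x n0))//.
      by rewrite (mulrC (root4 n)^-1%R).
  have b0 : (0 <= (root4 n)^-1 :> R)%R by rewrite invr_ge0 root4_ge0.
  have t5 (x : n.-tuple R) : 0 <= (root4 n)^-1%:E * (empirical_moment 5 x)%:E.
    by rewrite -EFinM lee_fin mulr_ge0// empirical_moment_ge0.
  rewrite ge0_integralZl//; last 2 first.
  - by apply: emeasurable_funD => //; exact: emeasurable_funD.
  - by move=> x _; rewrite !adde_ge0.
  rewrite ge0_integralD//; last 2 first.
  - by move=> x _; rewrite adde_ge0.
  - exact: emeasurable_funD.
  rewrite ge0_integralD// ge0_integralZl//; last first.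
    by move=> x _; rewrite lee_fin empirical_moment_ge0.
  by rewrite integral_empirical_moment5// -EFinM (mulrC m5).
apply/fine_cvgP; split; first by apply: nearW.
apply/cvgrPdist_le => e e0.
pose dl := (e / (3 * (K + 1)))%R.
have K1 : (0 < 3 * (K + 1))%R by rewrite mulr_gt0// ltr_wpDl.
have dl0 : (0 < dl)%R by rewrite divr_gt0.
have h2 := weak_mean sigma2E dl0.
have h4 := weak_mean mu4E dl0.
have h5 : \forall n \near \oo, (m5 / root4 n <= dl)%R.
  have : (m5 * (root4 n)^-1 @[n --> \oo] --> m5 * 0)%R.
    by apply: cvgM; [exact: cvg_cst|exact: cvg_root4V].
  rewrite mulr0 => /cvgrPdist_le /(_ _ dl0); apply: filterS => n.
  rewrite sub0r normrN; apply: le_trans; exact: ler_norm.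
near=> n.
have n0 : (0 < n)%N by near: n; exists 1%N.
rewrite -lee_fin; change (`|(L - fine (tilted_mass rho n s))%R|%:E <= e%:E).
rewrite distrC.
have := bound n n0; rewrite -{1}(fineK (fin n)) -EFinB/= => /le_trans; apply.
apply: (@le_trans _ _ (K%:E * (dl%:E + dl%:E + dl%:E))).
  rewrite lee_wpmul2l ?lee_fin// leeD//; last by rewrite lee_fin; near: n.
  by apply: leeD; near: n.
rewrite -!EFinD -EFinM lee_fin /dl.
rewrite (_ : K * _ = e * (K / (K + 1)))%R; last by field; rewrite gt_eqF// ltr_wpDl.
rewrite ler_piMr ?(ltW e0)// ler_pdivrMr ?ltr_wpDl// mul1r lerDl//.
Unshelve. all: by end_near. Qed.

Let kappa := (mu4 / (12 * sigma2 ^+ 2))%R.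

(** The bound tilted_mass_le is Gaussian, so dominated convergence applies to
    test functions with at most quadratic growth. *)
Lemma cvg_integral_tilted_mass (p : R -> R) (M : R) : measurable_fun setT p ->
  (forall s, 0 <= p s <= M * (1 + s ^+ 2))%R ->
  \int[leb]_s ((p s)%:E * tilted_mass rho n s) @[n --> \oo] -->
  \int[leb]_s (p s * expR (- (kappa * s ^+ 4)))%:E /\
  (forall n, \int[leb]_s ((p s)%:E * tilted_mass rho n s) < +oo) /\
  \int[leb]_s (p s * expR (- (kappa * s ^+ 4)))%:E < +oo.
Proof.
move=> mp pM.
have M0 : (0 <= M)%R by have := pM 0%R; rewrite expr0n addr0 mulr1; lra.
pose g (s : R) := ((24 * M * expR (12^-1))%:E * (expR (- (24^-1 * (s - 0) ^+ 2)))%:E).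
have mgs := @measurable_exp_gauss R 24^-1 0.
have c0 : (0 <= 24 * M * expR (12^-1))%R by rewrite !mulr_ge0 ?expR_ge0.
have ig : leb.-integrable setT g.
  apply/integrableP; split; first exact: measurable_funeM.
  under eq_integral do rewrite gee0_abs ?mule_ge0 ?lee_fin ?expR_ge0//.
  by rewrite ge0_integralZl// integral_gauss_scaled ?invr_gt0// -EFinM ltry.
(* 1 + s^2 <= 24 exp (s^2/24) leaves half of the exponent s^2/12. *)
have dom n s : `|(p s)%:E * tilted_mass rho n s| <= g s.
  have /andP[p0 pMs] := pM s.
  rewrite gee0_abs ?mule_ge0 ?tilted_mass_ge0//.
  apply: (@le_trans _ _ ((M * (1 + s ^+ 2))%:E * (expR (- ((s ^+ 2 - 1) / 12)))%:E)).
    by apply: lee_pmul => //; [exact: tilted_mass_ge0|exact: tilted_mass_le].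
  rewrite /g -!EFinM lee_fin subr0.
  rewrite (_ : - ((s ^+ 2 - 1) / 12) = 12^-1 - 24^-1 * s ^+ 2 - 24^-1 * s ^+ 2)%R; last by field.
  rewrite expRD expRD -!mulrA [leRHS]mulrCA ler_wpM2l//.
  rewrite mulrCA [leRHS]mulrCA ler_wpM2l ?expR_ge0//.
  rewrite mulrA ler_wpM2r ?expR_ge0// expRN ler_pdivrMr ?expR_gt0//.
  have := expR_ge1Dx (24^-1 * s ^+ 2)%R; lra.
have lim s : (p s)%:E * tilted_mass rho n s @[n --> \oo] -->
    (p s * expR (- (kappa * s ^+ 4)))%:E.
  by rewrite EFinM; apply: cvgeZl => //; exact: cvg_tilted_mass.
have ig_lty : \int[leb]_s g s < +oo.
  rewrite -ge0_fin_numE; first exact: (integrable_fin_num measurableT ig).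
  by apply: integral_ge0 => s _; rewrite mule_ge0 ?lee_fin ?expR_ge0.
split.
  apply: (@dominated_cvg _ _ _ leb setT measurableT _ _ g) => //.
  move=> n; apply: emeasurable_funM; first exact/measurable_EFinP.
  exact: measurable_tilted_mass.
split; last first.
  apply: le_lt_trans ig_lty; apply: ge0_le_integral => //.
  - by move=> s _; rewrite lee_fin mulr_ge0 ?expR_ge0//; have /andP[] := pM s.
  - apply/measurable_EFinP; apply: measurable_funM => //.
    apply: continuous_measurable_fun; exact: continuous_exp_quartic.
  - exact: measurable_funeM.
  - move=> s _; apply: (cvge_le _ (lim s)); apply: nearW => n.
    by apply: le_trans (dom n s); exact: lee_abs.
move=> n; apply: le_lt_trans ig_lty.
apply: ge0_le_integral => //.
- by move=> s _; rewrite mule_ge0 ?tilted_mass_ge0// lee_fin; have /andP[] := pM s.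
- apply: emeasurable_funM; first exact/measurable_EFinP.
  exact: measurable_tilted_mass.
- exact: measurable_funeM.
- by move=> s _; apply: le_trans (dom n s); exact: lee_abs.
Qed.

End tilted_mass_limit.

(** * Removal of the Gaussian smoothing and conclusion *)

Section real_sequences.
Context {R : realType}.

(** The last term vanishes for fixed e since beta tends to 0, and e is arbitrary. *)
Lemma cvg_ratio (j nf n1 n2 beta : nat -> R) (F D Q : R) :
  nf n @[n --> \oo] --> F -> n1 n @[n --> \oo] --> D -> n2 n @[n --> \oo] --> Q ->
  beta n @[n --> \oo] --> 0 -> D != 0 ->
  (forall e, 0 < e -> exists C, forall n, (0 < n)%N ->
     `|j n - nf n| <= e * (n1 n + n2 n) + C * beta n * n1 n) ->
  j n / n1 n @[n --> \oo] --> F / D.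
Proof.
move=> cf c1 c2 cb D0 H.
apply: cvgM; last exact: cvgV.
rewrite -[F]addr0 (_ : j = fun n => nf n + (j n - nf n)); last first.
  by apply/funext => n; rewrite addrCA subrr addr0.
apply: cvgD => //; apply/cvgrPdist_le => e e0.
pose q := `|D| + `|Q| + 1.
have q0 : 0 < q by rewrite ltr_wpDl// addr_ge0.
have d0 : 0 < e / (2 * q) by rewrite divr_gt0// mulr_gt0.
have [C HC] := H _ d0.
have lim : e / (2 * q) * (n1 n + n2 n) + C * beta n * n1 n @[n --> \oo] -->
    e / (2 * q) * (D + Q) + C * 0 * D.
  apply: cvgD; first by apply: cvgM; [exact: cvg_cst|exact: cvgD].
  by apply: cvgM => //; apply: cvgM => //; exact: cvg_cst.
have lt : e / (2 * q) * (D + Q) + C * 0 * D < e.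
  rewrite mulr0 mul0r addr0 (@le_lt_trans _ _ (e / (2 * q) * q))//.
    rewrite ler_pM2l// (le_trans (ler_norm _))// (le_trans (ler_normD _ _))//.
    by rewrite lerDl.
  by rewrite (_ : e / (2 * q) * q = e / 2); [lra|field; rewrite gt_eqF].
near=> n; rewrite sub0r normrN (le_trans (HC n _))//; first by near: n; exists 1%N.
near: n; have := @cvgr_le R _ \oo _ _ _ lim e lt; exact.
Unshelve. all: by end_near. Qed.

End real_sequences.

Section moments.
Local Open Scope ereal_scope.
Context {R : realType}.
Variable rho : probability R R.

Let mpow k : measurable_fun setT (fun z : R => (`|z| ^+ k)%:E).
Proof. by apply/measurable_EFinP/measurable_funX; exact: normr_measurable. Qed.

Lemma moment_lty k m : (k <= m)%N -> \int[rho]_z (`|z| ^+ m)%:E < +oo ->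
  \int[rho]_z (`|z| ^+ k)%:E < +oo.
Proof.
move=> km hm.
apply: (@le_lt_trans _ _ (\int[rho]_z (1 + (`|z| ^+ m)%:E))).
  apply: ge0_le_integral => //.
  - by apply: emeasurable_funD => //; exact: mpow.
  - move=> z _; rewrite -EFinD lee_fin.
    have [z1|/ltW z1] := leP `|z|%R 1%R.
      by rewrite (le_trans (exprn_ile1 _ (normr_ge0 z) z1))// lerDl exprn_ge0.
    by rewrite (le_trans (ler_weXn2l z1 km))// lerDr.
rewrite ge0_integralD//.
by rewrite integral_cst//= probability_setT mule1 lte_add_pinfty// ltry.
Qed.

(** A vanishing absolute moment forces z = 0 almost everywhere, hence the Dirac
    mass. *)
Lemma moment_gt0 k : ~ (forall A : set R, measurable A -> rho A = \d_(0%R : R) A) ->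
  0 < \int[rho]_z (`|z| ^+ k)%:E.
Proof.
move=> nd; rewrite lt0e integral_ge0 ?andbT//.
apply/eqP => I0; apply: nd => A mA.
have : \int[rho]_z `|(`|z| ^+ k)%:E| = 0.
  by rewrite -I0; apply: eq_integral => z _; rewrite gee0_abs ?lee_fin ?exprn_ge0.
move=> /(ae_eq_integral_abs rho measurableT (mpow k)) ae0.
transitivity (\int[rho]_z (\1_A z)%:E); first by rewrite integral_indic// setIT.
transitivity (\int[rho]_(z in [set: R]) (\1_A (0%R : R))%:E); last first.
  by rewrite integral_cst//= probability_setT mule1 diracE.
apply: ae_eq_integral => //; first exact/measurable_EFinP.
apply: filterS ae0 => z /(_ I) [] /eqP; rewrite expf_eq0 normr_eq0 => /andP[_ /eqP ->].
by [].
Qed.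

End moments.

Section limit_law.
Local Open Scope ereal_scope.
Context {R : realType}.
Notation leb := (@lebesgue_measure R).

Lemma integral_quartic_gt0 (k : R) : (0 < k)%R ->
  0 < \int[leb]_s (expR (- (k * s ^+ 4)))%:E.
Proof.
move=> k0; apply: (@lt_le_trans _ _ (\int[leb]_(s in `[0%R, 1%R]) (expR (- k))%:E)).
  rewrite integral_cst//= lebesgue_measure_itv/= lte01 oppr0 adde0 mule1.
  by rewrite lte_fin expR_gt0.
have mG : measurable_fun setT (fun s : R => (expR (- (k * s ^+ 4)))%:E).
  apply/measurable_EFinP; apply: continuous_measurable_fun.
  exact: continuous_exp_quartic.
apply: (@le_trans _ _ (\int[leb]_(s in `[0%R, 1%R]) (expR (- (k * s ^+ 4)))%:E)).
  apply: ge0_le_integral => //.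
  - exact: measurable_funTS.
  - move=> s /=; rewrite in_itv/= => /andP[s0 s1].
    rewrite lee_fin ler_expR lerN2 ler_piMr ?(ltW k0)//.
    by rewrite exprn_ile1.
exact: ge0_subset_integral.
Qed.

Lemma Gamma_quarter_gt0 : (0 < Gamma 4^-1 :> R)%R.
Proof.
have := integral_quartic_gt0 (@ltr01 R); rewrite integral_quartic//.
by rewrite lte_fin powR1 mulr1 pmulr_lgt0// invr_gt0.
Qed.

Variables (sigma2 mu4 : R).
Hypotheses (s0 : (0 < sigma2)%R) (m0 : (0 < mu4)%R).
Let kappa := (mu4 / (12 * sigma2 ^+ 2))%R.

Lemma kappa_gt0 : (0 < kappa)%R.
Proof. by rewrite divr_gt0// mulr_gt0// exprn_gt0. Qed.

(** Since 4 mu4 / (3 sigma2^2) = 16 kappa, the prefactor of limit_density is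
    2 kappa^(1/4) / Gamma (1/4), the inverse of integral_quartic. *)
Lemma limit_densityE s : limit_density sigma2 mu4 s =
  ((fine (\int[leb]_t (expR (- (kappa * t ^+ 4)))%:E))^-1 *
   expR (- (kappa * s ^+ 4)))%R.
Proof.
have k0 := kappa_gt0; have G0 := Gamma_quarter_gt0.
have kp : (0 < kappa `^ 4^-1)%R by exact: powR_gt0.
rewrite integral_quartic//= /limit_density mulNr; congr (_ * _)%R.
rewrite (_ : 4 * mu4 / (3 * sigma2 ^+ 2) = 2 `^ 4%:R * kappa)%R; last first.
  by rewrite powR_mulrn// /kappa; field; rewrite gt_eqF.
rewrite powRM ?powR_ge0 ?ltW// -powRrM mulfV ?pnatr_eq0// powRr1//.
by field; rewrite !gt_eqF.
Qed.

End limit_law.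

Section cw_expectation.
Local Open Scope ereal_scope.
Context {R : realType}.
Notation leb := (@lebesgue_measure R).
Variable rho : probability R R.
Variables (n : nat) (dO : measure_display) (Omega : measurableType dO)
  (P : probability Omega R) (X : {RV P >-> n.-tuple R}).
Hypothesis X_law : forall A, measurable A -> distribution P X A = cw_law rho n A.

Lemma cw_Z_ge0 : (0 <= cw_Z rho n)%R.
Proof. by apply: Rintegral_ge0 => x _; exact: cw_weight_ge0. Qed.

Lemma expectation_cw (f : R -> R) : measurable_fun setT f -> (forall s, 0 <= f s)%R ->
  \int[P]_w (f (self_normalized n (X w)))%:E =
  (cw_Z rho n)^-1%:E *
  \int[power_prob rho n]_x (f (self_normalized n x) * cw_weight x)%:E.
Proof.
move=> mf f0.
have mfV : measurable_fun setT (fun x : n.-tuple R => (f (self_normalized n x))%:E).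
  by apply/measurable_EFinP; apply: measurableT_comp => //; exact: measurable_self_normalized.
have Zi0 : (0 <= (cw_Z rho n)^-1)%R by rewrite invr_ge0 cw_Z_ge0.
rewrite -(@ge0_integral_distribution _ _ _ _ _ P X (fun x => (f (self_normalized n x))%:E))//.
rewrite (@integral_density _ _ R (power_prob rho n) (distribution P X)
  (fun x => (cw_Z rho n)^-1 * cw_weight x)%R)//.
- rewrite -ge0_integralZl//.
  + by apply: eq_integral => x _; rewrite -!EFinM mulrCA.
  + apply/measurable_EFinP; apply: measurable_funM; last exact: measurable_cw_weight.
    exact/measurable_EFinP.
  + by move=> x _; rewrite lee_fin mulr_ge0 ?cw_weight_ge0.
- by apply: measurable_funM => //; exact: measurable_cw_weight.
- by move=> x; rewrite mulr_ge0 ?cw_weight_ge0.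
- move=> A mA; transitivity (cw_law rho n A); first exact: X_law.
  rewrite /cw_law -ge0_integralZl//.
  + by apply: measurable_funTS; apply/measurable_EFinP; exact: measurable_cw_weight.
  + by move=> x _; rewrite lee_fin cw_weight_ge0.
- by move=> x; rewrite lee_fin.
- by move=> x; rewrite lee_fin.
Qed.

End cw_expectation.

Section nonneg_test_function.
Local Open Scope ereal_scope.
Context {R : realType}.
Notation leb := (@lebesgue_measure R).
Variable rho : probability R R.
Hypothesis rho_symmetric : forall A : set R, measurable A ->
       pushforward rho (-%R : R -> R) A = rho A.
Variables (sigma2 mu4 m5 : R).
Hypothesis sigma2E : \int[rho]_z (`|z| ^+ 2)%:E = sigma2%:E.
Hypothesis mu4E : \int[rho]_z (`|z| ^+ 4)%:E = mu4%:E.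
Hypothesis m5E : \int[rho]_z (`|z| ^+ 5)%:E = m5%:E.
Hypothesis sigma2_gt0 : (0 < sigma2)%R.
Hypothesis mu4_gt0 : (0 < mu4)%R.
Let kappa := (mu4 / (12 * sigma2 ^+ 2))%R.

Variables (d : nat -> measure_display) (Omega : forall n, measurableType (d n))
  (P : forall n, probability (Omega n) R) (X : forall n, {RV (P n) >-> n.-tuple R}).
Hypothesis X_law : forall n, (0 < n)%N -> forall A, measurable A ->
  distribution (P n) (X n) A = cw_law rho n A.

Let mass n (p : R -> R) : R := fine (\int[leb]_s ((p s)%:E * tilted_mass rho n s)).
Let lim_mass (p : R -> R) : R := fine (\int[leb]_s (p s * expR (- (kappa * s ^+ 4)))%:E).

Let mass_props (p : R -> R) (M : R) : measurable_fun setT p ->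
  (forall s, 0 <= p s <= M * (1 + s ^+ 2))%R ->
  mass n p @[n --> \oo] --> lim_mass p /\
  forall n, joint_integral rho (fun q : n.-tuple R * R => p q.2) = (mass n p)%:E.
Proof.
move=> mp pM.
have [h [hn hl]] := cvg_integral_tilted_mass rho_symmetric sigma2E mu4E m5E sigma2_gt0 mp pM.
have p0 s : (0 <= p s)%R by have /andP[] := pM s.
split.
  apply: fine_cvg; rewrite fineK// ge0_fin_numE//.
  by apply: integral_ge0 => s _; rewrite lee_fin mulr_ge0 ?expR_ge0.
move=> n; rewrite joint_integral_snd// fineK// ge0_fin_numE//.
by apply: integral_ge0 => s _; rewrite mule_ge0 ?lee_fin ?tilted_mass_ge0.
Qed.

(** Up to the common factor gauss_mass n, the expectation of f at the
    self-normalized sum and its normalization cw_Z are joint integrals; the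
    former is compared with the smoothed one and the limit is taken in the
    quotient. *)
Lemma cvg_expectation_nonneg (f : R -> R) (M : R) : continuous f ->
  (forall s, 0 <= f s <= M)%R ->
  fine (\int[P n]_w (f (self_normalized n (X n w)))%:E) @[n --> \oo] -->
  (lim_mass f / lim_mass (fun=> 1))%R.
Proof.
move=> cf fM.
have mf : measurable_fun setT f by exact: continuous_measurable_fun.
have f0 s : (0 <= f s)%R by have /andP[] := fM s.
have M0 : (0 <= M)%R by apply: le_trans (f0 0%R) _; have /andP[] := fM 0%R.
have [cF jF] : mass n f @[n --> \oo] --> lim_mass f /\
    forall n, joint_integral rho (fun q : n.-tuple R * R => f q.2) = (mass n f)%:E.
  apply: (@mass_props f M) => // s; have /andP[-> /=] := fM s.
  by move=> /le_trans; apply; rewrite ler_peMr// lerDl sqr_ge0.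
have [c1 j1] : mass n (fun=> 1%R) @[n --> \oo] --> lim_mass (fun=> 1%R) /\
    forall n, joint_integral rho (fun q : n.-tuple R * R => 1%R) = (mass n (fun=> 1%R))%:E.
  apply: (@mass_props (fun=> 1%R) 1%R) => // s.
  by rewrite ler01 mul1r lerDl sqr_ge0.
have [c2 j2] : mass n (fun s => s ^+ 2)%R @[n --> \oo] --> lim_mass (fun s => s ^+ 2)%R /\
    forall n, joint_integral rho (fun q : n.-tuple R * R => q.2 ^+ 2)%R =
      (mass n (fun s => s ^+ 2)%R)%:E.
  apply: (@mass_props (fun s => s ^+ 2)%R 1%R) => // s.
  by rewrite sqr_ge0 /= mul1r lerDr ler01.
pose fV n (q : n.-tuple R * R) := f (self_normalized n q.1).
have mfV n : measurable_fun setT (@fV n).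
  by apply: measurableT_comp => //; exact: (measurableT_comp (@measurable_self_normalized R n)).
pose j n := fine (joint_integral rho (@fV n)).
have jE n : joint_integral rho (@fV n) = (j n)%:E.
  rewrite fineK// ge0_fin_numE; last by apply: joint_integral_ge0 => q; exact: f0.
  apply: (@le_lt_trans _ _ (joint_integral rho (fun q : n.-tuple R * R => M * 1)%R)).
    apply: joint_integral_le => // q; first exact: f0.
    by rewrite mulr1; have /andP[] := fM (self_normalized n q.1).
  by rewrite (@joint_integralZ _ rho n M (fun=> 1%R))// j1 -EFinM ltry.
have D0 : lim_mass (fun=> 1%R) != 0%R.
  rewrite gt_eqF// /lim_mass; under eq_integral do rewrite mul1r.
  have k0 : (0 < kappa)%R by exact: kappa_gt0.
  by apply: fine_gt0; rewrite integral_quartic_gt0//= integral_quartic_lty.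
have cb : (8 / root4 n ^+ 2)%R @[n --> \oo] --> (0 : R)%R.
  have h : (8 * ((root4 n)^-1 * (root4 n)^-1))%R @[n --> \oo] --> (8 * (0 * 0) : R)%R.
    by apply: cvgM; [exact: cvg_cst|apply: cvgM; exact: cvg_root4V].
  rewrite !mulr0 in h; apply: cvg_trans h; apply: near_eq_cvg.
  by apply: nearW => n; rewrite expr2 invfM.
have lim : (j n / mass n (fun=> 1))%R @[n --> \oo] -->
    (lim_mass f / lim_mass (fun=> 1))%R.
  apply: (cvg_ratio cF c1 c2 cb D0) => e e0.
  have [C C0 HC] := quadratic_modulus cf fM e0.
  exists C => n n0.
  have le1 := @joint_integral_compare _ rho n (@fV n) (fun q => f q.2) e C n0 (mfV n).
  have le2 := @joint_integral_compare _ rho n (fun q => f q.2) (@fV n) e C n0.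
  have mf2 : measurable_fun setT (fun q : n.-tuple R * R => f q.2).
    exact: measurableT_comp.
  have {}le1 := le1 mf2 (fun q => f0 _) (fun q => f0 _) (ltW e0) C0.
  have {}le2 := le2 mf2 (mfV n) (fun q => f0 _) (fun q => f0 _) (ltW e0) C0.
  pose err := e%:E * (mass n (fun=> 1%R))%:E +
    e%:E * (mass n (fun s => s ^+ 2)%R)%:E +
    (C * (8 / root4 n ^+ 2))%:E * (mass n (fun=> 1%R))%:E.
  rewrite ler_norml; apply/andP; split.
    have : joint_integral rho (fun q : n.-tuple R * R => f q.2) <=
        joint_integral rho (@fV n) + err.
      rewrite /err -j1 -j2; apply: le2 => q.
      have := HC (self_normalized n q.1) q.2; rewrite /fV ler_norml => /andP[+ _]; lra.
    by rewrite jF jE /err -!EFinM -!EFinD lee_fin; lra.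
  have : joint_integral rho (@fV n) <=
      joint_integral rho (fun q : n.-tuple R * R => f q.2) + err.
    rewrite /err -j1 -j2; apply: le1 => q.
    have := HC (self_normalized n q.1) q.2; rewrite /fV ler_norml => /andP[_]; lra.
  by rewrite jF jE /err -!EFinM -!EFinD lee_fin; lra.
apply: cvg_trans lim; apply: near_eq_cvg; near=> n.
have n0 : (0 < n)%N by near: n; exists 1%N.
have g0 : (0 < gauss_mass n :> R)%R by exact: gauss_mass_gt0.
have int_of (p : R -> R) (r : R) : measurable_fun setT p -> (forall s, 0 <= p s)%R ->
    joint_integral rho (fun q : n.-tuple R * R => p (self_normalized n q.1)) = r%:E ->
    \int[power_prob rho n]_x (p (self_normalized n x) * cw_weight x)%:E =
    ((gauss_mass n)^-1 * r)%:E.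
  move=> mp p0; rewrite joint_integral_self_normalized// => H.
  rewrite EFinM -H muleA -EFinM mulVf ?mul1e// gt_eqF//.
have ZE : cw_Z rho n = ((gauss_mass n)^-1 * mass n (fun=> 1%R))%R.
  rewrite /cw_Z /Rintegral.
  have -> : \int[power_prob rho n]_x (cw_weight x)%:E =
     \int[power_prob rho n]_x (1 * cw_weight x)%:E.
    by apply: eq_integral => x _; rewrite mul1r.
  by rewrite (int_of (fun=> 1%R) (mass n (fun=> 1%R))).
rewrite (expectation_cw (X_law n0))// (int_of f (j n))// ZE -EFinM/=.
by rewrite invfM invrK mulrACA mulfV ?gt_eqF// mul1r mulrC.
Unshelve. all: by end_near. Qed.

End nonneg_test_function.

(** Reduces a bounded test function to a nonnegative one. *)
Lemma integral_shift (dO : measure_display) (Omega : measurableType dO) (R : realType)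
  (P : probability Omega R) (h : Omega -> R) (M : R) :
  measurable_fun setT h -> (forall w, `|h w| <= M) ->
  (\int[P]_w (h w)%:E = (fine (\int[P]_w (h w + M)%:E) - M)%:E)%E.
Proof.
move=> mh hM.
have ih : P.-integrable setT (EFin \o h).
  apply: measurable_bounded_integrable => //.
    by rewrite -ge0_fin_numE// fin_num_measure.
  exists M; split; first exact: num_real.
  by move=> y My w _; exact: le_trans (hM w) (ltW My).
have fh : (\int[P]_w (h w)%:E)%E \is a fin_num by exact: (integrable_fin_num _ ih).
under [in RHS]eq_integral do rewrite EFinD.
rewrite integralD//=; last exact: finite_measure_integrable_cst.
rewrite integral_cst//= probability_setT mule1 -(fineK fh) -EFinD/=.
by rewrite addrK.
Qed.

Section limit_probability.
Local Open Scope ereal_scope.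
Context {R : realType}.
Notation leb := (@lebesgue_measure R).
Variables (sigma2 mu4 : R).
Hypotheses (s0 : (0 < sigma2)%R) (m0 : (0 < mu4)%R).
Let kappa := (mu4 / (12 * sigma2 ^+ 2))%R.
Let I := fine (\int[leb]_t (expR (- (kappa * t ^+ 4)))%:E).

Let IE : \int[leb]_t (expR (- (kappa * t ^+ 4)))%:E = I%:E.
Proof.
have k0 : (0 < kappa)%R by exact: kappa_gt0.
rewrite fineK// ge0_fin_numE; first exact: integral_quartic_lty.
by apply: integral_ge0 => t _; rewrite lee_fin expR_ge0.
Qed.

Let I0 : (0 < I)%R.
Proof.
have k0 : (0 < kappa)%R by exact: kappa_gt0.
by rewrite -lte_fin -IE integral_quartic_gt0.
Qed.

Let measurable_quartic : measurable_fun setT (fun t : R => expR (- (kappa * t ^+ 4)))%R.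
Proof. by apply: continuous_measurable_fun; exact: continuous_exp_quartic. Qed.

Let measurable_limit_density : measurable_fun setT (limit_density sigma2 mu4).
Proof.
rewrite (_ : limit_density _ _ = fun s => I^-1 * expR (- (kappa * s ^+ 4)))%R.
  exact: measurable_funM.
by apply/funext => s; rewrite limit_densityE.
Qed.

Let limit_density_ge0 s : (0 <= limit_density sigma2 mu4 s)%R.
Proof. by rewrite limit_densityE// mulr_ge0 ?expR_ge0// invr_ge0 ltW. Qed.

Let integral_mul_density (f : R -> R) :
  measurable_fun setT f -> (forall s, 0 <= f s)%R ->
  \int[leb]_s ((f s)%:E * (limit_density sigma2 mu4 s)%:E) =
  I^-1%:E * \int[leb]_s (f s * expR (- (kappa * s ^+ 4)))%:E.
Proof.
move=> mf f0; rewrite -ge0_integralZl.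
- by apply: eq_integral => s _; rewrite limit_densityE// -!EFinM mulrCA.
- exact: measurableT.
- by apply/measurable_EFinP; exact: measurable_funM.
- by move=> s _; rewrite lee_fin mulr_ge0 ?expR_ge0.
- by rewrite lee_fin invr_ge0 ltW.
Qed.

Lemma limit_probability : exists2 nu : probability R R,
  (forall A, measurable A ->
    nu A = \int[leb]_(s in A) (limit_density sigma2 mu4 s)%:E) &
  forall f : R -> R, measurable_fun setT f -> (forall s, 0 <= f s)%R ->
    fine (\int[nu]_s (f s)%:E) =
    (fine (\int[leb]_s (f s * expR (- (kappa * s ^+ 4)))%:E) /
     fine (\int[leb]_s (1 * expR (- (kappa * s ^+ 4)))%:E))%R.
Proof.
have [nu nuE] : exists nu : probability R R, forall A, measurable A ->
    nu A = \int[leb]_(s in A) (limit_density sigma2 mu4 s)%:E.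
  apply: density_probability => //.
  have := @integral_mul_density (fun=> 1%R) (measurable_cst _) (fun=> ler01).
  under eq_integral do rewrite mul1e.
  move=> ->; under eq_integral do rewrite mul1r.
  by rewrite IE -EFinM mulVf// gt_eqF.
exists nu => // f mf f0.
have mfE : measurable_fun setT (EFin \o f) by exact/measurable_EFinP.
(* nu and the Lebesgue measure live on two structures of measurable space over
   the same Borel sets; id transports nu from one to the other. *)
have mid : measurable_fun setT (id : R -> measurableTypeR R) by exact: measurable_id.
have <- : \int[pushforward nu (id : R -> measurableTypeR R)]_s (f s)%:E =
    \int[nu]_s (f s)%:E.
  by rewrite ge0_integral_pushforward// => s _; rewrite lee_fin.
rewrite (@integral_density _ _ R leb (pushforward nu (id : R -> measurableTypeR R))
  (limit_density sigma2 mu4)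
  measurable_limit_density limit_density_ge0 nuE (EFin \o f))//.
rewrite integral_mul_density//.
under [X in (_ / fine X)%R]eq_integral do rewrite mul1r.
rewrite -/I mulrC; case: (\int[leb]_s _) => [r| |] //=.
- by rewrite gt0_muley ?lte_fin ?invr_gt0// mulr0.
- by rewrite gt0_muleNy ?lte_fin ?invr_gt0// mulr0.
Qed.

End limit_probability.

Theorem theorem1 (R : realType) (rho : probability R R)
    (rho_symmetric : forall A : set R, measurable A ->
       pushforward rho (-%R : R -> R) A = rho A)
    (rho_neq_dirac0 : ~ (forall A : set R, measurable A -> rho A = \d_(0 : R) A))
    (rho_moment5 : (\int[rho]_z (`|z| ^+ 5)%:E < +oo)%E)
    (sigma2 mu4 : R)
    (sigma2E : sigma2 = \int[rho]_z (z ^+ 2))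
    (mu4E : mu4 = \int[rho]_z (z ^+ 4))
    (d : nat -> measure_display)
    (Omega : forall n, measurableType (d n))
    (P : forall n, probability (Omega n) R)
    (X : forall n, {RV (P n) >-> n.-tuple R})
    (X_law : forall n, (0 < n)%N -> forall A, measurable A ->
       distribution (P n) (X n) A = cw_law rho n A) :
  exists2 nu : probability R R,
    forall A, measurable A ->
      nu A = (\int[lebesgue_measure]_(s in A) (limit_density sigma2 mu4 s)%:E)%E &
    cvg_in_distribution P (fun n => self_normalized n \o X n) nu.
Proof.
have momE k m : (k <= 5)%N -> m = fine (\int[rho]_z (`|z| ^+ k)%:E)%E ->
    (\int[rho]_z (`|z| ^+ k)%:E = m%:E)%E.
  move=> k5 ->; rewrite fineK// ge0_fin_numE; first exact: moment_lty k5 rho_moment5.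
  by apply: integral_ge0 => z _; rewrite lee_fin exprn_ge0.
have abs2 (z : R) : `|z| ^+ 2 = z ^+ 2 by rewrite real_normK ?num_real.
have s2E : (\int[rho]_z (`|z| ^+ 2)%:E = sigma2%:E)%E.
  apply: momE => //; rewrite sigma2E /Rintegral; congr fine.
  by apply: eq_integral => z _; rewrite abs2.
have m4E : (\int[rho]_z (`|z| ^+ 4)%:E = mu4%:E)%E.
  apply: momE => //; rewrite mu4E /Rintegral; congr fine.
  by apply: eq_integral => z _; rewrite -[4%N]/(2 * 2)%N !exprM abs2.
have m5E := momE 5%N _ isT erefl.
have s0 : 0 < sigma2 by rewrite -lte_fin -s2E moment_gt0.
have m0 : 0 < mu4 by rewrite -lte_fin -m4E moment_gt0.
have [nu nuE nuI] := limit_probability s0 m0.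
exists nu => // f cf [N [Nr bN]].
pose M : R := `|N| + 1.
have fM s : `|f s| <= M.
  apply: (bN M _ s I); rewrite /M (le_lt_trans (real_ler_norm Nr))// ltrDl//.
have mf : measurable_fun setT f by exact: continuous_measurable_fun.
pose g s := f s + M.
have cg : continuous g by move=> s; apply: cvgD; [exact: cf|exact: cvg_cst].
have gM s : 0 <= g s <= 2 * M.
  by have := fM s; rewrite ler_norml /g; lra.
have := cvg_expectation_nonneg rho_symmetric s2E m4E m5E s0 m0 X_law cg gM.
have mg : measurable_fun setT g by exact: continuous_measurable_fun.
have g0 s : 0 <= g s by have /andP[] := gM s.
rewrite -(nuI g mg g0) => lim.
rewrite (integral_shift nu mf fM).
rewrite (_ : (fun n => _) = fun n =>
  (fine (\int[P n]_w (g (self_normalized n (X n w)))%:E)%E - M)%:E); last first.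
  apply/funext => n; rewrite unlock.
  rewrite (@integral_shift _ _ _ (P n) (fun w => f (self_normalized n (X n w))) M)//.
  apply: (measurableT_comp mf).
  exact: (measurableT_comp (@measurable_self_normalized R n) (measurable_funPT (X n))).
apply: cvg_EFin; first exact: nearW.
by apply: cvgB => //; exact: cvg_cst.
Qed.
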